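(* Let $P$ be a pair of pants with $\pi_1(P)=\langle a,b\rangle$, where $a$ and $b$ correspond to two boundary curves of $P$ and $ab$ corresponds to the third boundary curve. Let $u$ and $v$ be two cyclically reduced words in the letters $\{a^{\pm1},b^{\pm1}\}$. If $uv$ is cyclically reduced and $u$ starts and ends with different letters, then for all $X\in\mathcal{T}(P)$ we have $$\ell_X(u)<\ell_X(uv).$$
   Context: A pair of pants $P$ is an oriented surface of genus $0$ with three boundary components; its fundamental group is free on the two generators $a,b$. A hyperbolic structure on $P$ is a Riemannian metric of constant curvature $-1$ for which each boundary component is realized by a simple closed geodesic or by a cusp; the Teichmüller space $\mathcal{T}(P)$ is the space of isotopy classes of hyperbolic structures on $P$. A word in the letters $\{a^{\pm1},b^{\pm1}\}$ is reduced if no two adjacent letters are inverse to each other; it is cyclically reduced if moreover its first and last letters are not inverse to each other. Letters are different if they are different elements of $\{a,a^{-1},b,b^{-1}\}$. Any reduced word $w$ corresponds to a homotopy class $[\alpha]$ of closed curves $\alpha$ in $P$ (curves are always assumed not to be homotopic to a point), and $uv$ denotes the concatenation of the words $u$ and $v$. For $X\in\mathcal{T}(P)$, $\ell_X(w)$ denotes the $X$-length of the geodesic representative in $[\alpha]$; it satisfies $2\cosh(\ell_X(w)/2)=|\mathrm{tr}\,\rho(w)|$ for any representation $\rho:\pi_1(P)\to\mathrm{PSL}(2,\mathbb{R})$ associated to $X$, so that a boundary curve realized by a cusp has length $0$.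
   Formalization: The formal theorem takes v non-empty and excludes the case where ab is a cusp and uv is a power of ab up to inversion and cyclic permutation; there both lengths are 0 (e.g. u = v = ab), so the strict inequality fails. *)

(* Defs.v *)
From HB Require Import structures.
From mathcomp Require Import all_boot all_order all_algebra.
From mathcomp Require Import complex.
From mathcomp Require Import all_classical all_reals all_analysis.

Set Implicit Arguments.
Unset Strict Implicit.
Unset Printing Implicit Defensive.

Import Order.TTheory GRing.Theory Num.Theory numFieldNormedType.Exports.

Local Open Scope classical_set_scope.
Local Open Scope ring_scope.
Local Open Scope complex_scope.

(* First component: false for a, true for b.  Second component: true for the
   inverse of that generator. *)
Definition letter := (bool * bool)%type.
Definition word := seq letter.

Definition letter_a : letter := (false, false).
Definition letter_b : letter := (true, false).
Definition letter_inv (x : letter) : letter := (x.1, ~~ x.2).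

Definition reduced (w : word) : bool :=
  sorted (fun x y => y != letter_inv x) w.

Definition cyclically_reduced (w : word) : bool :=
  reduced w && (if w is x :: s then last x s != letter_inv x else true).

(* False on the empty word, which has no first letter. *)
Definition starts_and_ends_differently (w : word) : bool :=
  if w is x :: s then last x s != x else false.

(* The cyclically reduced words of the closed curves that run n times around
   the third boundary curve, in either direction. *)
Definition third_boundary_power (w : word) : Prop :=
  exists c : word, exists n : nat,
    c \in [:: [:: letter_a; letter_b]; [:: letter_b; letter_a];
              [:: letter_inv letter_b; letter_inv letter_a];
              [:: letter_inv letter_a; letter_inv letter_b]] /\
    w = flatten (nseq n c).

Section HyperbolicPlane.
Variable R : realType.

Definition upper_half_plane : set R[i] := [set z | 0 < complex.Im z].

Definition mobius (g : 'M[R]_2) (z : R[i]) : R[i] :=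
  ((g 0 0)%:C * z + (g 0 1)%:C) / ((g 1 0)%:C * z + (g 1 1)%:C).

Definition arcosh (x : R) : R := ln (x + Num.sqrt (x ^+ 2 - 1)).

Definition hdist (z w : R[i]) : R :=
  arcosh (1 + ComplexField.Normc.normc (z - w) ^+ 2
              / (2 * complex.Im z * complex.Im w)).

(* SL(2,R) acts transitively on the sides of geodesics and on horodiscs, so
   one model of each suffices. *)
Definition half_plane (D : set R[i]) : Prop :=
  exists g : 'M[R]_2, \det g = 1 /\
    D = mobius g @` [set z | 0 < complex.Im z /\ 0 < complex.Re z].

Definition horodisc (D : set R[i]) : Prop :=
  exists g : 'M[R]_2, \det g = 1 /\
    D = mobius g @` [set z | 1 < complex.Im z].

Definition translation_length (g : 'M[R]_2) : R :=
  inf [set hdist z (mobius g z) | z in upper_half_plane].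

Definition rep_letter (A B : 'M[R]_2) (x : letter) : 'M[R]_2 :=
  let M := if x.1 then B else A in if x.2 then M^-1 else M.

(* The representation of the free group <a, b> with a |-> A, b |-> B. *)
Definition rep (A B : 'M[R]_2) (w : word) : 'M[R]_2 :=
  \prod_(x <- w) rep_letter A B x.

(* The words c such that, in the quotient of the hyperbolic plane by the image
   of the representation, c runs once around an end: some half-plane
   (respectively horodisc) is invariant under c, is moved off itself by all
   elements outside <c>, and hence projects injectively, modulo <c>, to a
   funnel behind a simple closed geodesic homotopic to c (respectively to a
   cusp neighbourhood).  The sign is there because SL(2,R) -> PSL(2,R) has
   kernel {1, -1}. *)
Definition boundary_word (A B : 'M[R]_2) (c : word) : Prop :=
  exists D : set R[i],
    [/\ half_plane D \/ horodisc D,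
        mobius (rep A B c) @` D = D &
        forall h : word,
          (exists n : int, rep A B h = rep A B c ^ n \/
                           rep A B h = - rep A B c ^ n) \/
          (mobius (rep A B h) @` D) `&` D = set0].

End HyperbolicPlane.

(* A marked hyperbolic structure on the pair of pants, given by a holonomy
   representation of <a, b> into PSL(2,R).  As <a, b> is free, such a
   representation lifts to SL(2,R), and lifts A, B of the images of a, b are
   recorded.  The structure is the quotient of the hyperbolic plane by the
   image (a discrete faithful representation of a free group of rank 2), with
   its funnels cut off along their closed geodesics; a, b and ab are required
   to be boundary curves, which singles out the pair of pants: in a one-holed
   torus the only boundary class is that of the commutator of the generators.
   Isotopy classes of structures correspond to conjugacy classes of such
   representations; conjugate ones have the same translation lengths.  Both
   orientations of the surface are covered. *)
Record hyperbolic_pants (R : realType) := HyperbolicPants {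
  hol_a : 'M[R]_2;
  hol_b : 'M[R]_2;
  det_hol_a : \det hol_a = 1;
  det_hol_b : \det hol_b = 1;
  hol_faithful : forall w : word, reduced w ->
    rep hol_a hol_b w = 1 \/ rep hol_a hol_b w = - 1 -> w = [::];
  hol_discrete : exists2 e : R, 0 < e & forall w : word,
    `|rep hol_a hol_b w - 1| < e -> rep hol_a hol_b w = 1;
  boundary_a : boundary_word hol_a hol_b [:: letter_a];
  boundary_b : boundary_word hol_a hol_b [:: letter_b];
  boundary_ab : boundary_word hol_a hol_b [:: letter_a; letter_b]
}.

(* The geodesic in the class of w lifts to the axis of the holonomy of w, along
   which that isometry translates by its translation length; this is 0 when w
   is homotopic to a cusp. *)
Definition geodesic_length (R : realType) (X : hyperbolic_pants R) (w : word) :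
    R :=
  translation_length (rep (hol_a X) (hol_b X) w).

(* When ab is a cusp, all its powers have length 0, and l(u) < l(uv) fails for
   instance for u = v = ab. *)
Definition cusp_power (R : realType) (X : hyperbolic_pants R) (w : word) :
    Prop :=
  geodesic_length X [:: letter_a; letter_b] = 0 /\ third_boundary_power w.

(* Main.v *)
Require Import Defs.
From mathcomp Require Import all_boot all_order all_algebra.
From mathcomp Require Import complex.
From mathcomp Require Import all_classical all_reals all_analysis.
From mathcomp Require Import ring lra.

Set Implicit Arguments.
Unset Strict Implicit.
Unset Printing Implicit Defensive.

Import Order.TTheory GRing.Theory Num.Theory numFieldNormedType.Exports.

Local Open Scope ring_scope.

(** Lengths increase with traces: l(g) is a strictly increasing function of
    (tr g)^2 >= 4 ([ltr_translation_length], [translation_length_parabolic]), so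
    the claim is an inequality between traces of words in A and B.

    The pair of pants is the double of a right-angled hexagon, possibly with
    ideal vertices.  Up to sign, A = s1 s0 and B = s0 s2, where s0, s1, s2 are
    the reflections in three pairwise disjoint geodesics, none of which separates
    the other two; hence AB = s1 s2 up to sign.  Each geodesic bounds an interval
    of the circle at infinity, that is, a cone V_i in the plane, and s_i maps
    every other V_j into V_i, up to sign.  In bases of the cones made of
    eigenvectors of the s_i, the products of reflections thus become products of
    matrices [transition i j] with nonnegative entries ([mirror_frame],
    [tr_rep]).  The whole comparison rests on the triangle inequality
    [transition i j <= transition i k * transition k j] ([transition_triangle]),
    which holds entrywise: visiting an additional side of the hexagon can only
    increase a product of transitions, just as it can only lengthen a billiard
    path.  Written as a cyclic sequence of sides, uv arises from u by inserting
    sides in one gap, namely where the last letter of u meets its first letter,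
    and these two letters involve different generators ([path_trace_lt]).  The
    insertion strictly increases the trace ([transition_detour],
    [transition_zigzag]) unless the sequence only ever alternates between s1 and
    s2 while AB is parabolic ([transition_hyperbolic]); then uv is a power of a
    cusp, which is the excluded case.

    That A and B have this form follows from their traces: all of tr A, tr B and
    tr AB have absolute value at least 2, and their product is negative
    ([pants_traces], [pants_normal_form]).  The sign is where the hypothesis that
    a, b and ab are all boundary curves enters.  If C is a boundary element of
    positive trace with invariant half-plane or horodisc D, and D is disjoint from
    its image under H, then k |-> tr(C^k H) is strictly monotone; were the product
    of the traces positive, the boundary element of largest trace would contradict
    this together with the recurrence satisfied by these traces
    ([boundary_not_longest]). *)

(** * Two-by-two matrices *)

Section TwoByTwo.
Variable R : comUnitRingType.
Implicit Types (M N : 'M[R]_2) (a b c d : R).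

Definition mx2 a b c d : 'M[R]_2 :=
  \matrix_(i, j) if i == 0 then if j == 0 then a else b
                 else if j == 0 then c else d.

Lemma mx2E a b c d :
  (mx2 a b c d 0 0 = a) * (mx2 a b c d 0 1 = b) *
  (mx2 a b c d 1 0 = c) * (mx2 a b c d 1 1 = d).
Proof. by rewrite /mx2 !mxE. Qed.

Lemma ord2P (i : 'I_2) : i = 0 \/ i = 1.
Proof. by case: i => [[|[|//]] hi]; [left|right]; apply: val_inj. Qed.

Lemma sum2E (F : 'I_2 -> R) : \sum_i F i = F 0 + F 1.
Proof.
by rewrite big_ord_recl big_ord1; congr (_ + F _); apply: val_inj.
Qed.

Lemma mul2E M N i j : (M * N) i j = M i 0 * N 0 j + M i 1 * N 1 j.
Proof. by rewrite mxE sum2E. Qed.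

Lemma eq_mx2 M N : M 0 0 = N 0 0 -> M 0 1 = N 0 1 -> M 1 0 = N 1 0 ->
  M 1 1 = N 1 1 -> M = N.
Proof.
move=> h00 h01 h10 h11; apply/matrixP => i j.
by case: (ord2P i) => ->; case: (ord2P j) => ->.
Qed.

Lemma tr2E M : \tr M = M 0 0 + M 1 1.
Proof. by rewrite /mxtrace sum2E. Qed.

Lemma det2E M : \det M = M 0 0 * M 1 1 - M 0 1 * M 1 0.
Proof.
rewrite (expand_det_row _ 0) sum2E /cofactor !det_mx11 !mxE /=.
have -> : lift (0 : 'I_2) 0 = 1 by apply: val_inj.
have -> : lift (1 : 'I_2) 0 = 0 by apply: val_inj.
by rewrite /= expr0 expr1; ring.
Qed.

Lemma id2E : ((1 : 'M[R]_2) 0 0 = 1) * ((1 : 'M[R]_2) 0 1 = 0) *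
  ((1 : 'M[R]_2) 1 0 = 0) * ((1 : 'M[R]_2) 1 1 = 1).
Proof. by rewrite !mxE. Qed.

Lemma trM2C M N : \tr (M * N) = \tr (N * M).
Proof. exact: mxtrace_mulC. Qed.

Lemma det_unit2 M : \det M = 1 -> M \is a GRing.unit.
Proof. by move=> h; rewrite unitmxE h unitr1. Qed.

Lemma inv2E M : \det M = 1 -> M^-1 = mx2 (M 1 1) (- M 0 1) (- M 1 0) (M 0 0).
Proof.
move=> h; have u := det_unit2 h.
apply: (mulrI u); rewrite mulrV //.
move: h; rewrite det2E => h.
by apply: eq_mx2; rewrite !mul2E !mx2E !id2E -?h; ring.
Qed.

Lemma det2M M N : \det (M * N) = \det M * \det N.
Proof. exact: det_mulmx. Qed.

Lemma det2V M : \det M = 1 -> \det M^-1 = 1.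
Proof. by move=> h; rewrite det_inv h invr1. Qed.

Lemma tr_conj M N : N \is a GRing.unit -> \tr (N^-1 * M * N) = \tr M.
Proof. by move=> u; rewrite trM2C mulrA mulrV // mul1r. Qed.

End TwoByTwo.

(** * Moebius transformations and translation lengths *)

Section Mobius.
Local Open Scope complex_scope.
Variable R : realType.
Implicit Types (g h : 'M[R]_2) (z : R[i]).

Definition mobius_den g (x y : R) := (g 1 0 * x + g 1 1) ^+ 2 + (g 1 0 * y) ^+ 2.

Lemma mobiusE g (x y : R) : mobius g (x +i* y) =
  (((g 0 0 * x + g 0 1) * (g 1 0 * x + g 1 1) + g 0 0 * g 1 0 * y ^+ 2)
     / mobius_den g x y)
  +i* (\det g * y / mobius_den g x y).
Proof.
rewrite /mobius.
have lin (a b : R) : a%:C * (x +i* y) + b%:C = (a * x + b) +i* (a * y).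
  by apply/eqP; rewrite eq_complex /=; apply/andP; split; apply/eqP; ring.
rewrite !lin det2E /mobius_den.
apply/eqP; rewrite eq_complex /=; apply/andP; split; apply/eqP; ring.
Qed.

Lemma mobius_den_gt0 g (x y : R) : \det g = 1 -> 0 < y -> 0 < mobius_den g x y.
Proof.
rewrite det2E /mobius_den => h y0.
have [c0|c0] := eqVneq (g 1 0) 0; last first.
  apply: ltr_wpDl; rewrite ?sqr_ge0 // exprn_even_gt0 //= mulf_neq0 // gt_eqF //.
apply: ltr_wpDr; rewrite ?sqr_ge0 // c0 mul0r add0r exprn_even_gt0 //=.
by apply/eqP => d0; move: h; rewrite c0 d0 => /eqP; rewrite !mulr0 subr0 eq_sym oner_eq0.
Qed.

Lemma mobius_Im_gt0 g z : \det g = 1 -> 0 < complex.Im z ->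
  0 < complex.Im (mobius g z).
Proof.
case: z => x y h y0; rewrite mobiusE /= h mul1r divr_gt0 //.
exact: mobius_den_gt0.
Qed.

Lemma mobius_den_neq0 g z : \det g = 1 -> 0 < complex.Im z ->
  (g 1 0)%:C * z + (g 1 1)%:C != 0.
Proof.
case: z => x y h /= y0; apply/eqP => e.
have := mobius_den_gt0 x h y0; rewrite /mobius_den.
have [-> ->] : g 1 0 * x + g 1 1 = 0 /\ g 1 0 * y = 0.
  move/eqP: e; rewrite eq_complex /= => /andP [/eqP e1 /eqP e2].
  by split; [rewrite -e1|rewrite -e2]; ring.
by rewrite expr0n addr0 ltxx.
Qed.

Lemma mobiusM g h z : \det g = 1 -> \det h = 1 -> 0 < complex.Im z ->
  mobius (g * h) z = mobius g (mobius h z).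
Proof.
move=> dg dh z0; have n := mobius_den_neq0 dh z0.
have clear_den (p q : R[i]) : forall a b, b != 0 ->
  p * (a / b) + q = (p * a + q * b) / b.
  by move=> a b b0; rewrite mulrDl mulfK // mulrA.
rewrite /mobius !clear_den // invf_div mulrA divfK //.
by rewrite !mul2E !rmorphD !rmorphM /=; congr (_ / _); ring.
Qed.

Lemma mobius1 z : mobius 1 z = z.
Proof. by rewrite /mobius !id2E mul0r add0r mul1r addr0 divr1. Qed.

End Mobius.

Section TranslationLength.
Local Open Scope complex_scope.
Variable R : realType.
Implicit Types (g : 'M[R]_2) (x y t : R).

Lemma arcosh1 : arcosh (1 : R) = 0.
Proof. by rewrite /arcosh expr1n subrr sqrtr0 addr0 ln1. Qed.

Lemma ler_arcosh x y : 1 <= x -> x <= y -> arcosh x <= arcosh y.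
Proof.
move=> x1 xy; rewrite /arcosh ler_ln ?posrE.
- apply: lerD => //; apply: ler_wsqrtr; rewrite lerB // ler_sqr ?nnegrE; lra.
- by apply: ltr_wpDr; rewrite ?sqrtr_ge0 //; lra.
- by apply: ltr_wpDr; rewrite ?sqrtr_ge0 //; lra.
Qed.

Lemma ltr_arcosh x y : 1 <= x -> x < y -> arcosh x < arcosh y.
Proof.
move=> x1 xy; rewrite /arcosh ltr_ln ?posrE.
- apply: ltr_leD => //; apply: ler_wsqrtr; rewrite lerB // ler_sqr ?nnegrE; lra.
- by apply: ltr_wpDr; rewrite ?sqrtr_ge0 //; lra.
- by apply: ltr_wpDr; rewrite ?sqrtr_ge0 //; lra.
Qed.

(** For hyperbolic g its absolute value is 2 sinh (d) sinh (l / 2), where d is the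
    distance of x + i y to the axis and l the translation length; in particular it
    vanishes exactly on the axis. *)
Definition axis_defect g x y :=
  (g 1 0 * (x ^+ 2 + y ^+ 2) + (g 1 1 - g 0 0) * x - g 0 1) / y.

(** Writing P(z) = c z^2 + (d - a) z - b, one has |gz - z| = |P(z)| / |cz + d|
    and |P(z)|^2 / y^2 is the discriminant (tr g)^2 - 4 plus the squared defect. *)
Lemma hdist_mobius g x y : \det g = 1 -> 0 < y ->
  hdist (x +i* y) (mobius g (x +i* y)) =
  arcosh (((\tr g) ^+ 2 + axis_defect g x y ^+ 2) / 2 - 1).
Proof.
move=> dg y0; have D0 := mobius_den_gt0 x dg y0.
rewrite /hdist; congr arcosh; rewrite mobiusE dg.
rewrite /ComplexField.Normc.normc /= sqr_sqrtr ?addr_ge0 ?sqr_ge0 //.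
move: D0; set D := mobius_den g x y => D0.
have eD : D = (g 1 0 * x + g 1 1) ^+ 2 + (g 1 0 * y) ^+ 2 by [].
have D1 : D != 0 by rewrite gt_eqF.
have y1 : y != 0 by rewrite gt_eqF.
rewrite /axis_defect tr2E.
have key : (x * D - ((g 0 0 * x + g 0 1) * (g 1 0 * x + g 1 1) + g 0 0 * g 1 0 * y ^+ 2)) ^+ 2
   + (y * D - \det g * y) ^+ 2 =
   D * (y ^+ 2 * ((g 0 0 + g 1 1) ^+ 2 - 4 * \det g) +
     (g 1 0 * (x ^+ 2 + y ^+ 2) + (g 1 1 - g 0 0) * x - g 0 1) ^+ 2).
  by rewrite eD det2E; ring.
rewrite dg in key.
apply: (mulIf (x := 2 * y ^+ 2 * D)); first by rewrite !mulf_neq0 // ?pnatr_eq0 // expf_neq0.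
transitivity (2 * y ^+ 2 * D +
  ((x * D - ((g 0 0 * x + g 0 1) * (g 1 0 * x + g 1 1)
             + g 0 0 * g 1 0 * y ^+ 2)) ^+ 2 + (y * D - 1 * y) ^+ 2)).
  by field; rewrite D1 y1.
by rewrite key; field.
Qed.

Lemma translation_length_ge g : \det g = 1 -> 4 <= (\tr g) ^+ 2 ->
  arcosh ((\tr g) ^+ 2 / 2 - 1) <= translation_length g.
Proof.
move=> dg t4; apply: lb_le_inf.
  by exists (hdist 'i (mobius g 'i)); exists 'i => //; rewrite /upper_half_plane /= ltr01.
move=> _ [[x y] y0 <-]; rewrite hdist_mobius //.
apply: ler_arcosh; first lra.
have := sqr_ge0 (axis_defect g x y); lra.
Qed.

Lemma translation_length_le g x y : \det g = 1 -> 4 <= (\tr g) ^+ 2 -> 0 < y ->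
  translation_length g <= arcosh (((\tr g) ^+ 2 + axis_defect g x y ^+ 2) / 2 - 1).
Proof.
move=> dg t4 y0; rewrite -hdist_mobius //; apply: ge_inf; last first.
  by exists (x +i* y).
exists 0 => _ [[x' y'] y0' <-]; rewrite hdist_mobius // -arcosh1 ler_arcosh //.
have := sqr_ge0 (axis_defect g x' y'); lra.
Qed.

(** A point on the axis when g is hyperbolic; when g is parabolic the defect
    tends to 0 towards the fixed point. *)
Lemma small_axis_defect g (e : R) : \det g = 1 -> 4 <= (\tr g) ^+ 2 -> 0 < e ->
  exists x y, 0 < y /\ axis_defect g x y ^+ 2 < e.
Proof.
rewrite det2E tr2E /axis_defect => dg t4 e0.
set a := g 0 0 in dg t4 *; set b := g 0 1 in dg t4 *.
set c := g 1 0 in dg t4 *; set d := g 1 1 in dg t4 *.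
set D := (a + d) ^+ 2 - 4 in t4.
have eD : D = (a - d) ^+ 2 + 4 * b * c 
  by transitivity ((a + d) ^+ 2 - 4 * (a * d - b * c)); [rewrite dg mulr1|ring].
have D0 : 0 <= D by rewrite /D; lra.
have [c0|c0] := eqVneq c 0.
  have [ad|ad] := eqVneq a d.
    exists 0, ((b ^+ 2 + 1) / e + 1).
    have h : 0 < (b ^+ 2 + 1) / e by rewrite divr_gt0 //; have := sqr_ge0 b; lra.
    split; first lra.
    rewrite c0 ad subrr !mul0r !add0r expr_div_n sqrrN ltr_pdivrMr; last first.
      by apply: exprn_gt0; lra.
    set r := (X in X / e).
    have he : e * (r / e) = r by rewrite mulrC divfK // gt_eqF.
    move: h he; set q := r / e => h he.
    have r1 : b ^+ 2 < r by rewrite /r; lra.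
    nra.
  exists (b / (d - a)), 1; split => //.
  have da : d - a != 0 by rewrite subr_eq0 eq_sym.
  by rewrite c0 mul0r add0r mulrCA mulfV // mulr1 subrr mul0r expr0n.
have key (y : R) : c * (((a - d) / (2 * c)) ^+ 2 + y ^+ 2) + (d - a) * ((a - d) / (2 * c)) - b
   = c * y ^+ 2 - D / (4 * c).
  rewrite eD; field; exact: c0.
have [D1|D1] := eqVneq D 0.
  pose y := Num.min 1 (e / (c ^+ 2 + 1)).
  have cc : 0 < c ^+ 2 + 1 by have := sqr_ge0 c; lra.
  have ee : 0 < e / (c ^+ 2 + 1) by rewrite divr_gt0.
  have y0 : 0 < y by rewrite /y lt_min ltr01.
  exists ((a - d) / (2 * c)), y; split => //.
  rewrite key D1 mul0r subr0.
  have -> : c * y ^+ 2 / y = c * y by field; rewrite gt_eqF.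
  have y1 : y <= 1 by rewrite /y ge_min lexx.
  have y2 : y * (c ^+ 2 + 1) <= e by rewrite -ler_pdivlMr // /y ge_min lexx orbT.
  have := sqr_ge0 c; nra.
have Dp : 0 < D by rewrite lt_def D1.
have y0 : 0 < Num.sqrt D / (2 * `|c|).
  by rewrite divr_gt0 ?sqrtr_gt0 // mulr_gt0 ?normr_gt0.
have y2 : (Num.sqrt D / (2 * `|c|)) ^+ 2 = D / (4 * c ^+ 2).
  rewrite expr_div_n sqr_sqrtr // exprMn real_normK ?num_real //.
  by congr (_ / (_ * _)); rewrite expr2; ring.
exists ((a - d) / (2 * c)), (Num.sqrt D / (2 * `|c|)); split => //.
rewrite key y2.
have -> : c * (D / (4 * c ^+ 2)) - D / (4 * c) = 0 by field.
by rewrite mul0r expr0n.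
Qed.

Lemma ltr_translation_length g h : \det g = 1 -> \det h = 1 ->
  4 <= (\tr g) ^+ 2 -> (\tr g) ^+ 2 < (\tr h) ^+ 2 ->
  translation_length g < translation_length h.
Proof.
move=> dg dh t4 tgh.
have e0 : 0 < (\tr h) ^+ 2 - (\tr g) ^+ 2 by lra.
have [x [y [y0 hxy]]] := small_axis_defect dg t4 e0.
apply: le_lt_trans (translation_length_le x dg t4 y0) _.
apply: lt_le_trans (translation_length_ge dh _); last lra.
apply: ltr_arcosh; last lra.
have := sqr_ge0 (axis_defect g x y); lra.
Qed.

Lemma translation_length_parabolic g : \det g = 1 -> (\tr g) ^+ 2 = 4 ->
  translation_length g = 0.
Proof.
move=> dg t4; have t4' : 4 <= (\tr g) ^+ 2 by rewrite t4.
apply/eqP; rewrite eq_le; apply/andP; split; last first.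
  by apply: le_trans (translation_length_ge dg t4'); rewrite -arcosh1 ler_arcosh //; lra.
apply/ler_addgt0Pl => e e0; rewrite addr0.
pose f := Num.min 1 (e ^+ 2 / 16).
have f0 : 0 < f by rewrite lt_min ltr01 divr_gt0 // exprn_gt0.
have [x [y [y0 hxy]]] := small_axis_defect dg t4' f0.
apply: le_trans (translation_length_le x dg t4' y0) _.
move: hxy; rewrite t4; set E := axis_defect _ _ _ => hE.
have E0 := sqr_ge0 E.
have f1 : f <= 1 by rewrite /f ge_min lexx.
have f2 : f <= e ^+ 2 / 16 by rewrite /f ge_min lexx orbT.
have f3 : f <= e / 4.
  rewrite -(@ler_sqr _ f) ?nnegrE; [|lra|lra].
  by apply: le_trans (_ : f <= _); [nra|apply: le_trans f2 _; lra].
set s := (4 + E ^+ 2) / 2 - 1.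
have s1 : Num.sqrt (s ^+ 2 - 1) <= e / 2.
  rewrite -(@ger0_norm _ (e / 2)); last lra.
  rewrite -sqrtr_sqr; apply: ler_wsqrtr; rewrite /s; nra.
apply: le_trans (_ : s + Num.sqrt (s ^+ 2 - 1) - 1 <= _); last by rewrite /s in s1 *; lra.
rewrite /arcosh.
have := sqrtr_ge0 (s ^+ 2 - 1); set q := Num.sqrt _ => q0.
have -> : s + q = 1 + (s + q - 1) by ring.
by apply: le_trans (le_ln1Dx _) _; rewrite /s; lra.
Qed.

End TranslationLength.

(** * Half-planes and horodiscs at the boundary *)

Section Boundary.
Local Open Scope classical_set_scope.
Local Open Scope complex_scope.
Variable R : realType.
Implicit Types (g h K H C : 'M[R]_2) (x y t : R) (D : set R[i]).

(** Conjugation by g reduces the study of an invariant half-plane or horodisc to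
    the model it is the image of. *)
Lemma conj_stable g C D : \det g = 1 -> \det C = 1 ->
    (forall z, D z -> 0 < complex.Im z) ->
    mobius C @` (mobius g @` D) = mobius g @` D ->
  forall z, D z -> D (mobius (g^-1 * C * g) z) /\ D (mobius (g^-1 * C * g)^-1 z).
Proof.
move=> dg dC D0 eD z Dz.
have dgV := det2V dg; have ug := det_unit2 dg.
have dK : \det (g^-1 * C * g) = 1 by rewrite !det2M dgV dC dg !mulr1.
have back w : 0 < complex.Im w -> mobius g^-1 (mobius g w) = w.
  by move=> w0; rewrite -mobiusM // mulVr // mobius1.
have conjE w : 0 < complex.Im w ->
    mobius (g^-1 * C * g) w = mobius g^-1 (mobius C (mobius g w)).
  move=> w0; have := mobius_Im_gt0 dg w0 => w1.
  by rewrite mobiusM // ?det2M ?dgV ?dC ?mulr1 // mobiusM.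
split.
  have : (mobius C @` (mobius g @` D)) (mobius C (mobius g z)).
    by exists (mobius g z) => //; exists z.
  rewrite eD => -[w Dw ew].
  by rewrite conjE ?D0 // -ew back // D0.
have : (mobius g @` D) (mobius g z) by exists z.
rewrite -eD => -[_ [w Dw <-] ew].
have -> : z = mobius (g^-1 * C * g) w by rewrite conjE ?D0 // ew back // D0.
by rewrite -mobiusM ?D0 ?det2V // mulVr ?det_unit2 // mobius1.
Qed.

Lemma conj_disjoint g H D : \det g = 1 -> \det H = 1 ->
    (forall z, D z -> 0 < complex.Im z) ->
    (mobius H @` (mobius g @` D)) `&` (mobius g @` D) = set0 ->
  forall z, D z -> ~ D (mobius (g^-1 * H * g) z).
Proof.
move=> dg dH D0 eD z Dz Dw.
have dgV := det2V dg; have ug := det_unit2 dg.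
have z0 := D0 _ Dz.
suff : set0 (mobius H (mobius g z)) by [].
rewrite -eD; split; first by exists (mobius g z) => //; exists z.
exists (mobius (g^-1 * H * g) z) => //.
have dK : \det (g^-1 * H * g) = 1 by rewrite !det2M dgV dH dg !mulr1.
by rewrite -mobiusM // !mulrA mulrV // mul1r mobiusM.
Qed.

(** The real part of K z, up to the positive factor |cz + d|^2. *)
Definition re_num K x y :=
  (K 0 0 * x + K 0 1) * (K 1 0 * x + K 1 1) + K 0 0 * K 1 0 * y ^+ 2.

Lemma mobius_Re_gt0 K x y : \det K = 1 -> 0 < y ->
  (0 < complex.Re (mobius K (x +i* y))) = (0 < re_num K x y).
Proof.
by move=> dK y0; rewrite mobiusE /= pmulr_lgt0 // invr_gt0 mobius_den_gt0.
Qed.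

(** The zeros - q / p and - s / r of the two factors are in the order that leaves
    a positive interval on which both are positive, because p s > q r. *)
Lemma affine_pair_pos (p q r s : R) : p * s - q * r = 1 -> 0 < p -> 0 < s ->
  exists x, 0 < x /\ 0 < (p * x + q) * (r * x + s).
Proof.
move=> dK p0 s0.
have [r0|r0] := leP 0 r.
  have x0 : 0 < (`|q| + 1) / p.
    by apply: divr_gt0; [have := normr_ge0 q; lra|lra].
  exists ((`|q| + 1) / p); split => //; apply: mulr_gt0; last nra.
  have -> : p * ((`|q| + 1) / p) = `|q| + 1 by field; lra.
  by have := ler_norm (- q); rewrite normrN; lra.
have [q0|q0] := leP 0 q.
  have x0 : 0 < s / (2 * - r) by apply: divr_gt0; lra.
  exists (s / (2 * - r)); split => //; apply: mulr_gt0; first nra.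
  have -> : r * (s / (2 * - r)) = - s / 2 by field; lra.
  lra.
exists ((- q / p + s / - r) / 2); split.
  have : 0 < - q / p by apply: divr_gt0; lra.
  have : 0 < s / - r by apply: divr_gt0; lra.
  lra.
have -> : (p * ((- q / p + s / - r) / 2) + q) * (r * ((- q / p + s / - r) / 2) + s) =
   (p * s - q * r) ^+ 2 / (4 * - (p * r)) by field; lra.
apply: divr_gt0; last nra.
by rewrite dK expr1n ltr01.
Qed.

(** As y tends to 0 the numerator tends to the product (p x + q) (r x + s), which
    would be positive for some x > 0 if p and s had the same sign. *)
Lemma re_num_le0 K : \det K = 1 ->
    (forall x y, 0 < x -> 0 < y -> re_num K x y <= 0) ->
  K 0 0 * K 1 1 <= 0.
Proof.
rewrite det2E /re_num.
set p := K 0 0; set q := K 0 1; set r := K 1 0; set s := K 1 1 => dK hF.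
rewrite leNgt; apply/negP => ps.
have [x [x0 hx]] : exists x, 0 < x /\ 0 < (p * x + q) * (r * x + s).
  have [p0|p0|p0] := ltgtP p 0; last by rewrite p0 mul0r ltxx in ps.
    have s0 : s < 0 by nra.
    have [||| x [x0 hx]] := @affine_pair_pos (- p) (- q) (- r) (- s); try lra.
    by exists x; split => //; lra.
  by apply: affine_pair_pos => //; nra.
move: hx; set v := (_ * (_ + s)) => v0.
pose y := Num.min 1 (v / (`|p * r| + 1)).
have n0 : 0 < `|p * r| + 1 by have := normr_ge0 (p * r); lra.
have y0 : 0 < y by rewrite lt_min ltr01 divr_gt0.
have := hF _ _ x0 y0; rewrite -/v.
have y1 : y <= 1 by rewrite ge_min lexx.
have y2 : y * (`|p * r| + 1) <= v by rewrite -ler_pdivlMr // ge_min lexx orbT.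
have := ler_norm (- (p * r)); rewrite normrN.
have := normr_ge0 (p * r); move: `|_| y2 n0 => m y2 n0 m0 m1 h.
have m2 : m * y ^+ 2 <= m * y by nra.
nra.
Qed.

Definition quadrant : set R[i] := [set z | 0 < complex.Im z /\ 0 < complex.Re z].
Definition top_horodisc : set R[i] := [set z | 1 < complex.Im z].

Lemma quadrant_disjoint K : \det K = 1 ->
  (forall z, quadrant z -> ~ quadrant (mobius K z)) -> K 0 0 * K 1 1 <= 0.
Proof.
move=> dK h; apply: re_num_le0 => // x y x0 y0.
rewrite leNgt; apply/negP => F0; apply: (h (x +i* y)) => //.
by split; rewrite ?mobius_Im_gt0 // mobius_Re_gt0.
Qed.

Lemma quadratic_pos (u v w : R) :
    (forall x y, 0 < x -> 0 < y -> 0 < u * (x ^+ 2 + y ^+ 2) + v * x + w) ->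
  0 <= u /\ 0 <= w.
Proof.
move=> F0; split; rewrite leNgt; apply/negP => neg.
- pose y := 1 + `|u + v + w| / - u.
  have y1 : 0 <= `|u + v + w| / - u by apply: divr_ge0; [exact: normr_ge0|lra].
  have ey : u * y = u - `|u + v + w| by rewrite /y; field; lra.
  have y0 : 1 <= y by rewrite /y; lra.
  have y2 : y <= y ^+ 2 by nra.
  have uy : u * y ^+ 2 <= u * y by rewrite ler_wnM2l // ltW.
  have := F0 1 y ltr01 (lt_le_trans ltr01 y0).
  have := ler_norm (u + v + w); lra.
- pose m := 2 * `|u| + `|v| + 1.
  have m0 : 0 < m by rewrite /m; have := normr_ge0 u; have := normr_ge0 v; lra.
  pose e := Num.min 1 (- w / m).
  have e0 : 0 < e by rewrite lt_min ltr01 divr_gt0 //; lra.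
  have e1 : e <= 1 by rewrite ge_min lexx.
  have e2 : e * m <= - w by rewrite -ler_pdivlMr // ge_min lexx orbT.
  have := F0 e e e0 e0; have := ler_norm u; have := ler_norm v.
  move=> hv hu h.
  have ve : v * e <= `|v| * e by nra.
  have ue : u * e <= `|u| * e by nra.
  have uee : u * e * e <= `|u| * e.
    apply: le_trans (_ : `|u| * e * e <= _); first by rewrite ler_wpM2r // ltW.
    by rewrite ler_piMr // mulr_ge0 ?normr_ge0 // ltW.
  move: e2; rewrite /m; lra.
Qed.

(** Rotating by z |-> -1/z carries the quadrant off itself, so the bound on the
    product of antidiagonal entries is [re_num_le0] for the composite. *)
Lemma quadrant_into K : \det K = 1 ->
    (forall z, quadrant z -> quadrant (mobius K z)) ->
  [/\ 0 <= K 0 0 * K 1 0, 0 <= K 0 1 * K 1 1 & 0 <= K 0 1 * K 1 0].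
Proof.
move=> dK h.
have F0 x y : 0 < x -> 0 < y -> 0 < re_num K x y.
  move=> x0 y0; have [] := h (x +i* y); first by split.
  by move=> _; rewrite mobius_Re_gt0.
have [|h1 h2] := @quadratic_pos (K 0 0 * K 1 0)
    (K 0 0 * K 1 1 + K 0 1 * K 1 0) (K 0 1 * K 1 1).
  by move=> x y x0 y0; have := F0 _ _ x0 y0; rewrite /re_num; lra.
split => //.
pose W := mx2 0 (-1) 1 0 * K.
have dW : \det W = 1 by rewrite det2M dK det2E !mx2E; ring.
have : W 0 0 * W 1 1 <= 0.
  apply: re_num_le0 => // x y x0 y0; have := F0 _ _ x0 y0.
  by rewrite /W /re_num !mul2E !mx2E; lra.
by rewrite /W !mul2E !mx2E; lra.
Qed.

(** As b c >= 0, the product a d is at least 1; since a c >= 0 for K and c d <= 0 for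
    its inverse, c = 0, and b = 0 likewise. *)
Lemma quadrant_stable K : \det K = 1 ->
    (forall z, quadrant z -> quadrant (mobius K z) /\ quadrant (mobius K^-1 z)) ->
  K 0 1 = 0 /\ K 1 0 = 0.
Proof.
move=> dK h.
have [|a1 a2 a3] := @quadrant_into K dK; first by move=> z /h [].
have [|b1 b2 _] := @quadrant_into K^-1 (det2V dK); first by move=> z /h [].
move: b1 b2; rewrite (inv2E dK) !mx2E; move: (dK); rewrite det2E.
set a := K 0 0 in a1 *; set b := K 0 1 in a2 a3 *.
set c := K 1 0 in a1 a3 *; set d := K 1 1 in a2 *.
move=> ad_bc b1 b2.
have ad : 1 <= a * d by lra.
have h1 : 0 <= (a * c) * (- (c * d)) by apply: mulr_ge0; lra.
have h2 : 0 <= (b * d) * (- (a * b)) by apply: mulr_ge0; lra.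
split; apply/eqP; rewrite -sqrf_eq0 eq_le sqr_ge0 andbT.
- have := sqr_ge0 b; nra.
- have := sqr_ge0 c; nra.
Qed.

Lemma top_horodisc_stable K : \det K = 1 ->
    (forall z, top_horodisc z -> top_horodisc (mobius K z) /\ top_horodisc (mobius K^-1 z)) ->
  [/\ K 1 0 = 0, K 0 0 = K 1 1 & K 0 0 ^+ 2 = 1].
Proof.
move=> dK h.
have key L : \det L = 1 -> (forall z, top_horodisc z -> top_horodisc (mobius L z)) ->
    forall y, 1 < y -> (L 1 1) ^+ 2 + (L 1 0) ^+ 2 * y ^+ 2 <= y.
  move=> dL hL y y1; have := hL (0 +i* y) y1.
  have y0 : 0 < y by lra.
  have D0 := mobius_den_gt0 0 dL y0.
  rewrite /top_horodisc mobiusE /= dL mul1r ltr_pdivlMr // mul1r /mobius_den.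
  by rewrite mulr0 add0r exprMn => /ltW.
have k1 := key K dK (fun z hz => (h z hz).1).
have k2 := key K^-1 (det2V dK) (fun z hz => (h z hz).2).
move: k1 k2; rewrite (inv2E dK) !mx2E sqrrN; move: (dK); rewrite det2E.
set a := K 0 0; set b := K 0 1; set c := K 1 0; set d := K 1 1.
move=> ad_bc k1 k2.
have c0 : c = 0.
  apply/eqP; rewrite -sqrf_eq0 eq_le sqr_ge0 andbT leNgt; apply/negP => c0.
  have y0 : 0 < (c ^+ 2)^-1 by rewrite invr_gt0.
  have e : c ^+ 2 * (c ^+ 2)^-1 = 1 by rewrite mulfV // gt_eqF.
  have y1 : 1 < 1 + (c ^+ 2)^-1 by lra.
  have := k1 _ y1; have := sqr_ge0 d; move: (c ^+ 2)^-1 e y0 => q e q0; nra.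
have le1 s : (forall y, 1 < y -> s <= y) -> s <= 1.
  move=> hs; rewrite leNgt; apply/negP => s1.
  have := hs ((1 + s) / 2); lra.
have d1 : d ^+ 2 <= 1.
  by apply: le1 => y /k1; rewrite c0 expr0n mul0r addr0.
have a1 : a ^+ 2 <= 1.
  by apply: le1 => y /k2; rewrite c0 expr0n mul0r addr0.
have ad : a * d = 1 by rewrite -ad_bc c0; ring.
have : (a - d) ^+ 2 <= 0 by nra.
rewrite le_eqVlt ltNge sqr_ge0 orbF sqrf_eq0 subr_eq0 => /eqP e.
by split => //; rewrite expr2 {2}e.
Qed.

Lemma top_horodisc_disjoint K : \det K = 1 ->
  (forall z, top_horodisc z -> ~ top_horodisc (mobius K z)) -> K 1 0 != 0.
Proof.
move=> dK h; apply/eqP => c0.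
have d0 : 0 < (K 1 1) ^+ 2.
  rewrite exprn_even_gt0 //=; apply/eqP => d0.
  by move: dK; rewrite det2E c0 d0 !mulr0 subr0 => /eqP; rewrite eq_sym oner_eq0.
have y1 : 1 < 1 + (K 1 1) ^+ 2 by lra.
apply: (h (0 +i* (1 + (K 1 1) ^+ 2))) => //.
rewrite /top_horodisc mobiusE /= dK mul1r /mobius_den c0 !mul0r add0r expr0n addr0.
by rewrite ltr_pdivlMr //; lra.
Qed.

End Boundary.

Section BoundaryTraces.
Local Open Scope classical_set_scope.
Variable R : realType.
Implicit Types (g h K H C : 'M[R]_2) (x y t : R) (D : set R[i]).

(** The first alternative is a funnel, the second a cusp.  In either case the
    disjointness of D from its image under H turns into a condition on the entries
    of H in the same basis. *)
Lemma boundary_normal_form C D : \det C = 1 -> half_plane D \/ horodisc D ->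
    mobius C @` D = D ->
  exists g, let K := g^-1 * C * g in
    [/\ \det g = 1, \det K = 1, K 1 0 = 0 &
      (K 0 1 = 0 /\ forall H, \det H = 1 -> (mobius H @` D) `&` D = set0 ->
          (g^-1 * H * g) 0 0 * (g^-1 * H * g) 1 1 <= 0) \/
      ([/\ K 0 0 = K 1 1, K 0 0 ^+ 2 = 1 & forall H, \det H = 1 ->
          (mobius H @` D) `&` D = set0 -> (g^-1 * H * g) 1 0 != 0])].
Proof.
move=> dC [] [g [dg ->]] inv; exists g => K.
  have dK : \det K = 1 by rewrite !det2M (det2V dg) dC dg !mulr1.
  have D0 (z : R[i]) : quadrant z -> 0 < complex.Im z by case.
  have [k1 k2] := quadrant_stable dK (conj_stable dg dC D0 inv).
  split=> //; left; split=> // H dH disj; apply: quadrant_disjoint.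
    by rewrite !det2M (det2V dg) dH dg !mulr1.
  exact: conj_disjoint.
have dK : \det K = 1 by rewrite !det2M (det2V dg) dC dg !mulr1.
have D0 (z : R[i]) : top_horodisc z -> 0 < complex.Im z by apply: lt_trans.
have [k1 k2 k3] := top_horodisc_stable dK (conj_stable dg dC D0 inv).
split=> //; right; split=> // H dH disj; apply: top_horodisc_disjoint.
  by rewrite !det2M (det2V dg) dH dg !mulr1.
exact: conj_disjoint.
Qed.

Lemma boundary_trace C D : \det C = 1 -> half_plane D \/ horodisc D ->
  mobius C @` D = D -> 4 <= (\tr C) ^+ 2.
Proof.
move=> dC hD inv; have [g /= [dg dK k0 _]] := boundary_normal_form dC hD inv.
rewrite -(tr_conj C (det_unit2 dg)) tr2E.
move: dK; rewrite det2E k0 mulr0 subr0; move: (_ 0 0) (_ 1 1) => m n mn.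
have := sqr_ge0 (m - n); nra.
Qed.

(** With C = diag (m, n) and p, s the diagonal entries of H, the sequence
    h(k) = tr (C^k H) = m^k p + n^k s is monotone, as p and s have opposite signs.
    If t = tr C bounds both h(0) and h(1), the recurrence h(k+1) + h(k-1) = t h(k)
    makes the neighbour of the smaller of the two on the far side too large:
    h(-1) <= h(0) gives h(1) >= (t - 1) h(0) >= 2 t - 2 > t. *)
Lemma opposite_signs_pos (m n p s : R) : m * n = 1 -> m != n -> p * s <= 0 ->
  0 < m + n -> 2 <= p + s -> 2 <= m * p + n * s ->
  p + s <= m + n -> m * p + n * s <= m + n -> False.
Proof.
move=> mn mNn ps t0 x2 y2 xt yt.
have m0 : 0 < m by nra.
have n0 : 0 < n by nra.
have t2 : 2 < m + n.
  have : 0 < (m - n) ^+ 2 by rewrite exprn_even_gt0 //= subr_eq0.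
  nra.
(* The recurrence h(k+1) + h(k-1) = t h(k) at k = 0 and at k = 1. *)
have e1 : (m + n) * (p + s) = (m * p + n * s) + (n * p + m * s) by ring.
have e2 : (m + n) * (m * p + n * s) = (m ^+ 2 * p + n ^+ 2 * s) + (p + s).
  by rewrite -[p + s]mul1r -mn; ring.
have big1 : n * p + m * s <= p + s -> False.
  move=> le; have : (m + n - 1) * 2 <= (m + n - 1) * (p + s) by rewrite ler_pM2l //; lra.
  lra.
have big2 : m ^+ 2 * p + n ^+ 2 * s <= m * p + n * s -> False.
  move=> le; 
  have : (m + n - 1) * 2 <= (m + n - 1) * (m * p + n * s) by rewrite ler_pM2l //; lra.
  lra.
have [p0|p0] := leP p 0; last have s0 : s <= 0 by rewrite pmulr_rle0 in ps.
  have [m1|m1] := leP 1 m.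
    have n1 : n <= 1 by nra.
    apply: big2; have : m * (m - 1) * p <= 0 by rewrite mulr_ge0_le0 // mulr_ge0; lra.
    have : n * (n - 1) * s <= 0 by rewrite mulr_le0_ge0 //; [rewrite mulr_ge0_le0|]; lra.
    lra.
  have n1 : 1 <= n by nra.
  apply: big1; have : (n - 1) * p <= 0 by rewrite mulr_ge0_le0; lra.
  have : (m - 1) * s <= 0 by rewrite mulr_le0_ge0; lra.
  lra.
have [m1|m1] := leP 1 m.
  have n1 : n <= 1 by nra.
  apply: big1; have : (n - 1) * p <= 0 by rewrite mulr_le0_ge0; lra.
  have : (m - 1) * s <= 0 by rewrite mulr_ge0_le0; lra.
  lra.
have n1 : 1 <= n by nra.
apply: big2; have : m * (m - 1) * p <= 0.
  by rewrite mulr_le0_ge0 //; [rewrite mulr_ge0_le0|]; lra.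
have : n * (n - 1) * s <= 0 by rewrite mulr_ge0_le0 // mulr_ge0; lra.
lra.
Qed.

Lemma opposite_signs (m n p s : R) : m * n = 1 -> m != n -> p * s <= 0 ->
  let t := m + n in let x := p + s in let y := m * p + n * s in
  0 < t * x * y -> 4 <= x ^+ 2 -> 4 <= y ^+ 2 ->
  x ^+ 2 <= t ^+ 2 -> y ^+ 2 <= t ^+ 2 -> False.
Proof.
move=> mn mNn ps t x y.
wlog t0 : m n mn mNn @t @x @y / 0 < t.
  move=> W; have [t0|t0|t0] := ltgtP 0 t; last by rewrite -t0 !mul0r ltxx.
    exact: W.
  by move=> h1 h2 h3 h4 h5; apply: (W (- m) (- n)); rewrite /t /x /y in t0 h1 h2 h3 h4 h5 *; lra.
wlog x0 : p s ps @x @y / 0 < x.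
  move=> W; have [x0|x0|x0] := ltgtP 0 x; last by rewrite -x0 mulr0 mul0r ltxx.
    exact: W.
  by move=> h1 h2 h3 h4 h5; apply: (W (- p) (- s)); rewrite /t /x /y in x0 h1 h2 h3 h4 h5 *; lra.
move=> h1 h2 h3 h4 h5.
have y0 : 0 < y by rewrite pmulr_rgt0 ?mulr_gt0 // in h1.
apply: (opposite_signs_pos mn mNn ps) => //; rewrite -/t -/x -/y.
- nra.
- nra.
- by move: h4; rewrite ler_sqr ?nnegrE; [|lra|lra].
- by move: h5; rewrite ler_sqr ?nnegrE; [|lra|lra].
Qed.

(** For a cusp, C is a translation up to sign; all three traces are then 2 in
    absolute value, and, again up to sign, tr (C H) - tr H is a nonzero multiple
    of the lower left entry of H. *)
Lemma boundary_not_longest C H D : \det C = 1 -> \det H = 1 ->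
  half_plane D \/ horodisc D -> mobius C @` D = D ->
  (mobius H @` D) `&` D = set0 -> C <> 1 -> C <> - 1 ->
  4 <= (\tr H) ^+ 2 -> 4 <= (\tr (C * H)) ^+ 2 ->
  0 < \tr C * \tr H * \tr (C * H) ->
  (\tr H) ^+ 2 <= (\tr C) ^+ 2 -> (\tr (C * H)) ^+ 2 <= (\tr C) ^+ 2 -> False.
Proof.
move=> dC dH hD inv disj C1 CN1.
have [g /= [dg dK k0 alt]] := boundary_normal_form dC hD inv.
have ug := det_unit2 dg.
have KE : C = g * (g^-1 * C * g) * g^-1.
  by rewrite !mulrA mulrV // mul1r mulrK.
have trH := tr_conj H ug; have trC := tr_conj C ug; have trCH := tr_conj (C * H) ug.
have eCH : g^-1 * (C * H) * g = (g^-1 * C * g) * (g^-1 * H * g).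
  by rewrite !mulrA mulrK.
rewrite eCH in trCH; rewrite -trH -trC -trCH.
have {}alt : let K := g^-1 * C * g in let L := g^-1 * H * g in
    (K 0 1 = 0 /\ L 0 0 * L 1 1 <= 0) \/
    [/\ K 0 0 = K 1 1, K 0 0 ^+ 2 = 1 & L 1 0 != 0].
  by case: alt => [[k1 /(_ _ dH disj)]|[k1 k2 /(_ _ dH disj)]] ?; [left|right].
move: (g^-1 * C * g) (g^-1 * H * g) dK k0 alt KE => K L dK k0 /= alt KE.
have K1 : K <> 1 by move=> e; apply: C1; rewrite KE e mulr1 mulrV.
have KN1 : K <> - 1 by move=> e; apply: CN1; rewrite KE e mulrN1 mulNr mulrV.
rewrite !tr2E !mul2E k0.
move: dK; rewrite det2E k0 mulr0 subr0 => dK.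
case: alt => [[k1 ps]|[k1 k2 r0]].
  rewrite k1 !mul0r addr0 add0r.
  have mNn : K 0 0 != K 1 1; last first.
    by move=> h1 h2 h3 h4 h5; exact: (opposite_signs dK mNn ps h3 h1 h2 h4 h5).
  apply/eqP => e; have : K 0 0 ^+ 2 = 1 by rewrite expr2 {2}e.
  move/eqP; rewrite sqrf_eq1 => /orP[] /eqP e1.
    by apply: K1; apply: eq_mx2; rewrite ?id2E // -e.
  by apply: KN1; apply: eq_mx2; rewrite !mxE ?id2E /= ?oppr0 // -?e.
have b0 : K 0 1 != 0.
  apply/eqP => b0; move/eqP: k2; rewrite sqrf_eq1 => /orP[] /eqP e1.
    by apply: K1; apply: eq_mx2; rewrite ?id2E // -k1.
  by apply: KN1; apply: eq_mx2; rewrite !mxE ?id2E /= ?oppr0 // -k1.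
rewrite -k1 !mul0r add0r.
have br : K 0 1 * L 1 0 != 0 by rewrite mulf_neq0.
move: (L 0 0) (L 1 1) (K 0 0) k2 => p s e e2.
move: (K 0 1 * L 1 0) br => q q0 h1 h2 h3 h4 h5.
have x4 : (p + s) ^+ 2 = 4 by apply/eqP; rewrite eq_le h1 andbT; nra.
have y4 : (e * p + q + e * s) ^+ 2 = 4 by apply/eqP; rewrite eq_le h2 andbT; nra.
have : (e * p + q + e * s) ^+ 2 = (e * (p + s)) ^+ 2 by rewrite y4 exprMn e2 x4 mul1r.
move/eqP; rewrite eqf_sqr => /orP[] /eqP h.
  by move/eqP: q0; apply; lra.
move: h3; rewrite h.
have -> : (e + e) * (p + s) * - (e * (p + s)) = - (2 * e ^+ 2 * (p + s) ^+ 2) by ring.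
by rewrite e2 x4; lra.
Qed.

End BoundaryTraces.

(** * Traces of the boundary elements of a pair of pants *)

Section Holonomy.
Variable R : realType.
Implicit Types (A B : 'M[R]_2) (w : word).

Lemma rep_cons A B x w : rep A B (x :: w) = rep_letter A B x * rep A B w.
Proof. by rewrite /rep big_cons. Qed.

Lemma rep_nil A B : rep A B [::] = 1.
Proof. by rewrite /rep big_nil. Qed.

Lemma rep1 A B x : rep A B [:: x] = rep_letter A B x.
Proof. by rewrite rep_cons rep_nil mulr1. Qed.

Lemma det_rep_letter A B x : \det A = 1 -> \det B = 1 ->
  \det (rep_letter A B x) = 1.
Proof.
by move=> dA dB; case: x => [] [] []; rewrite /rep_letter /= ?det2V.
Qed.

Lemma det_rep A B w : \det A = 1 -> \det B = 1 -> \det (rep A B w) = 1.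
Proof.
move=> dA dB; elim: w => [|x w IH]; first by rewrite rep_nil det1.
by rewrite rep_cons det2M det_rep_letter // IH mulr1.
Qed.

Lemma boundary_word_trace A B c : \det A = 1 -> \det B = 1 ->
  boundary_word A B c -> 4 <= (\tr (rep A B c)) ^+ 2.
Proof.
by move=> dA dB [D [hD inv _]]; apply: boundary_trace hD inv; rewrite det_rep.
Qed.

(** An element that does not commute with C is not a power of C, so the
    alternative in the definition of a boundary word yields disjointness. *)
Lemma boundary_word_not_longest A B c h : \det A = 1 -> \det B = 1 ->
  boundary_word A B c ->
  let C := rep A B c in let H := rep A B h in
  C * H <> H * C -> 4 <= (\tr H) ^+ 2 -> 4 <= (\tr (C * H)) ^+ 2 ->
  0 < \tr C * \tr H * \tr (C * H) ->
  (\tr H) ^+ 2 <= (\tr C) ^+ 2 -> (\tr (C * H)) ^+ 2 <= (\tr C) ^+ 2 -> False.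
Proof.
move=> dA dB [D [hD inv /(_ h) alt]] C H ncomm.
apply: (@boundary_not_longest _ C H D) => //; rewrite ?det_rep //.
- case: alt => // -[n eH]; case: ncomm.
  have cn : GRing.comm C (C ^ n) by exact/commrXz/commr_refl.
  by case: eH => eH; rewrite /H eH ?mulrN ?mulNr cn.
- by move=> e; apply: ncomm; rewrite e mulr1 mul1r.
- by move=> e; apply: ncomm; rewrite e mulrN1 mulN1r.
Qed.

Lemma hol_noncomm (X : hyperbolic_pants R) : hol_a X * hol_b X <> hol_b X * hol_a X.
Proof.
move=> e; have uA := det_unit2 (det_hol_a X); have uB := det_unit2 (det_hol_b X).
suff : [:: letter_a; letter_b; letter_inv letter_a; letter_inv letter_b] = [::] by [].
apply: (@hol_faithful R X) => //; left.
by rewrite !rep_cons rep_nil mulr1 /rep_letter /= mulrA e -mulrA (mulrA (hol_a X))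
  mulrV // mul1r mulrV.
Qed.

(** If the product were positive, the longest of a, b and ab could be taken as C,
    with H = b, a and b^-1 respectively, so that the third trace is tr (C H). *)
Lemma pants_traces (X : hyperbolic_pants R) :
  let A := hol_a X in let B := hol_b X in
  [/\ 4 <= (\tr A) ^+ 2, 4 <= (\tr B) ^+ 2, 4 <= (\tr (A * B)) ^+ 2 &
      \tr A * \tr B * \tr (A * B) < 0].
Proof.
move=> A B; have dA : \det A = 1 := det_hol_a X; have dB : \det B = 1 := det_hol_b X.
have uB := det_unit2 dB.
have ba := boundary_a X; have bb := boundary_b X; have bc := boundary_ab X.
have rA : rep A B [:: letter_a] = A by rewrite rep1.
have rB : rep A B [:: letter_b] = B by rewrite rep1.
have rBV : rep A B [:: letter_inv letter_b] = B^-1 by rewrite rep1.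
have rAB : rep A B [:: letter_a; letter_b] = A * B by rewrite rep_cons rB.
have tA : 4 <= (\tr A) ^+ 2 by rewrite -rA; apply: boundary_word_trace.
have tB : 4 <= (\tr B) ^+ 2 by rewrite -rB; apply: boundary_word_trace.
have tC : 4 <= (\tr (A * B)) ^+ 2 by rewrite -rAB; apply: boundary_word_trace.
split=> //; rewrite ltNge; apply/negP => ge0.
have nz (t : R) : 4 <= t ^+ 2 -> t != 0 by move=> h; apply/eqP => t0; move: h; rewrite t0; lra.
have gt0 : 0 < \tr A * \tr B * \tr (A * B) by rewrite lt_def ge0 !mulf_neq0 ?nz.
have nc := @hol_noncomm X; rewrite -/A -/B in nc.
have := @boundary_word_not_longest A B _ [:: letter_b] dA dB ba; rewrite /= rA rB => La.
have := @boundary_word_not_longest A B _ [:: letter_a] dA dB bb; rewrite /= rA rB => Lb.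
have := @boundary_word_not_longest A B _ [:: letter_inv letter_b] dA dB bc.
rewrite /= rBV rAB mulrK // => Lc.
have tBV : \tr B^-1 = \tr B.
  by rewrite (inv2E dB) !tr2E !mx2E addrC.
rewrite tBV in Lc; rewrite (trM2C B A) in Lb.
have {}La := La nc tB tC gt0.
have {}Lb : (\tr A) ^+ 2 <= (\tr B) ^+ 2 -> (\tr (A * B)) ^+ 2 <= (\tr B) ^+ 2 -> False.
  by apply: Lb => //; [move=> e; apply: nc|rewrite (mulrC (\tr B))].
have {}Lc : (\tr B) ^+ 2 <= (\tr (A * B)) ^+ 2 -> (\tr A) ^+ 2 <= (\tr (A * B)) ^+ 2 -> False.
  apply: Lc => //; last by rewrite -mulrA mulrC (mulrC (\tr B)).
  by move=> e; apply: nc; rewrite [in RHS]e mulrA mulrV // mul1r.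
move: ((\tr A) ^+ 2) ((\tr B) ^+ 2) ((\tr (A * B)) ^+ 2) La Lb Lc => a b c La Lb Lc.
have [ab|ab] := leP a b; have [bc'|bc'] := leP b c.
- by apply: Lc => //; lra.
- by apply: Lb => //; lra.
- have [ac|ac] := leP a c; [apply: Lc|apply: La] => //; lra.
- by apply: La; lra.
Qed.

End Holonomy.

(** * Normal form of the two generators *)

Section NormalForm.
Variable R : realType.
Implicit Types (A B W g : 'M[R]_2).

(** The columns are eigenvectors for s and - s; the sign of s is chosen so that
    they do not vanish. *)
Lemma diagonalize_traceless W : \tr W = 0 -> \det W < 0 ->
  exists g s, [/\ g \is a GRing.unit, s != 0 & W * g = g * mx2 s 0 0 (- s)].
Proof.
rewrite tr2E det2E => tW dW.
pose k := Num.sqrt (W 0 0 ^+ 2 + W 0 1 * W 1 0).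
have k2 : k ^+ 2 = W 0 0 ^+ 2 + W 0 1 * W 1 0.
  by rewrite sqr_sqrtr //; nra.
have k0 : k != 0 by rewrite -sqrf_eq0 k2; apply/eqP; nra.
have [s [s0 s2 ms]] : exists s,
    [/\ s != 0, s ^+ 2 = W 0 0 ^+ 2 + W 0 1 * W 1 0 & W 0 0 + s != 0].
  have [e|ne] := eqVneq (W 0 0 + k) 0; last by exists k.
  exists (- k); rewrite oppr_eq0 sqrrN; split=> //; apply/eqP => e'.
  by move/eqP: k0; apply; lra.
have W11 : W 1 1 = - W 0 0 by lra.
exists (mx2 (W 0 0 + s) (- W 0 1) (W 1 0) (W 0 0 + s)), s; split=> //.
  rewrite unitmxE det2E !mx2E unitfE.
  have -> : (W 0 0 + s) * (W 0 0 + s) - - W 0 1 * W 1 0 = 2 * s * (W 0 0 + s).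
    by lra.
  by rewrite !mulf_neq0 // pnatr_eq0.
by apply: eq_mx2; rewrite !mul2E !mx2E ?W11; lra.
Qed.

(** The shape of a pair of generators in the basis of eigenvectors of the
    reflection in the common perpendicular of their axes; the last condition says
    in which order the geodesics of the two other reflections follow each other. *)
Record symmetric_pair (P q r P' q' r' : R) : Prop := SymmetricPair {
  symmetric_P : 1 <= P; symmetric_P' : 1 <= P';
  symmetric_q : 0 < q; symmetric_r : 0 <= r; symmetric_q' : 0 <= q'; symmetric_r' : 0 < r';
  symmetric_det : q * r = P ^+ 2 - 1; symmetric_det' : q' * r' = P' ^+ 2 - 1;
  symmetric_order : (P + 1) * (P' + 1) <= q * r' }.

Local Ltac mx2_ring := by apply: eq_mx2; rewrite !mul2E !mx2E; ring.

(** Put al = (P + 1) (P' + 1) and be = (P - 1) (P' - 1).  The numbers q r' and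
    r q' have product al be and sum at least al + be, so one of them is at least al;
    swapping or changing the sign of a basis vector makes it q r', with q > 0. *)
Lemma off_diagonal_signs (P q r P' q' r' : R) : 1 <= P -> 1 <= P' ->
  q * r = P ^+ 2 - 1 -> q' * r' = P' ^+ 2 - 1 ->
  2 * P * P' - q * r' - r * q' <= - 2 ->
  exists h a b c d, [/\ h \is a GRing.unit,
    mx2 P q r P * h = h * mx2 P a b P,
    mx2 P' (- q') (- r') P' * h = h * mx2 P' (- c) (- d) P' &
    symmetric_pair P a b P' c d].
Proof.
move=> P1 P1' qr qr' tr.
have al0 : 0 < (P + 1) * (P' + 1) by apply: mulr_gt0; lra.
have finish h a b c d : h \is a GRing.unit -> a * b = P ^+ 2 - 1 -> c * d = P' ^+ 2 - 1 ->
    mx2 P q r P * h = h * mx2 P a b P ->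
    mx2 P' (- q') (- r') P' * h = h * mx2 P' (- c) (- d) P' ->
    (P + 1) * (P' + 1) <= a * d -> 0 < a ->
  exists h a b c d, [/\ h \is a GRing.unit,
    mx2 P q r P * h = h * mx2 P a b P,
    mx2 P' (- q') (- r') P' * h = h * mx2 P' (- c) (- d) P' &
    symmetric_pair P a b P' c d].
  move=> uh ab cd e1 e2 ad a0; exists h, a, b, c, d; split=> //.
  have d0 : 0 < d by rewrite -(pmulr_rgt0 d a0); lra.
  split=> //.
    by rewrite -(pmulr_rge0 b a0) ab; nra.
  by rewrite -(pmulr_lge0 c d0) cd; nra.
have dg (e1 e2 : R) : e1 != 0 -> e2 != 0 -> mx2 e1 0 0 e2 \is a GRing.unit.
  by move=> h1 h2; rewrite unitmxE det2E !mx2E mul0r subr0 unitfE mulf_neq0.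
have ds (e1 e2 : R) : e1 != 0 -> e2 != 0 -> mx2 0 e1 e2 0 \is a GRing.unit.
  by move=> h1 h2; rewrite unitmxE det2E !mx2E mul0r sub0r unitfE oppr_eq0 mulf_neq0.
have n1 : (1 : R) != 0 by rewrite oner_eq0.
have nN1 : (-1 : R) != 0 by rewrite oppr_eq0.
have [s1|s1] := leP ((P + 1) * (P' + 1)) (q * r').
  have [q0|q0|q0] := ltgtP q 0; last by move: s1; rewrite q0 mul0r; lra.
    apply: (finish (mx2 1 0 0 (-1)) (- q) (- r) (- q') (- r'));
      [exact: dg|lra|lra|mx2_ring|mx2_ring|lra|lra].
  apply: (finish (mx2 1 0 0 1) q r q' r'); [exact: dg|lra|lra|mx2_ring|mx2_ring|lra|lra].
have s2 : (P + 1) * (P' + 1) <= r * q'.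
  rewrite leNgt; apply/negP => s2.
  have : 0 < ((P + 1) * (P' + 1) - q * r') * ((P + 1) * (P' + 1) - r * q').
    by apply: mulr_gt0; lra.
  have -> : ((P + 1) * (P' + 1) - q * r') * ((P + 1) * (P' + 1) - r * q') =
    ((P + 1) * (P' + 1)) ^+ 2 - (P + 1) * (P' + 1) * (q * r' + r * q') + (q * r) * (q' * r').
    by ring.
  rewrite qr qr'.
  have -> : ((P + 1) * (P' + 1)) ^+ 2 - (P + 1) * (P' + 1) * (q * r' + r * q') +
      (P ^+ 2 - 1) * (P' ^+ 2 - 1) =
    (P + 1) * (P' + 1) * (2 * P * P' + 2 - q * r' - r * q') by ring.
  by rewrite pmulr_rgt0 //; lra.
have [r0|r0|r0] := ltgtP r 0; last by move: s2; rewrite r0 mul0r; lra.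
  apply: (finish (mx2 0 1 (-1) 0) (- r) (- q) (- r') (- q'));
    [exact: ds|lra|lra|mx2_ring|mx2_ring|lra|lra].
apply: (finish (mx2 0 1 1 0) r q r' q'); [exact: ds|lra|lra|mx2_ring|mx2_ring|lra|lra].
Qed.

(** The commutator A B - B A is, up to a scalar, the reflection that inverts both
    A and B.  Traces of A (A B - B A) and B (A B - B A) vanish, so in its eigenbasis A
    and B have equal diagonal entries. *)
Lemma pants_normal_form A B : \det A = 1 -> \det B = 1 ->
  2 <= \tr A -> 2 <= \tr B -> \tr (A * B) <= - 2 ->
  exists g P q r P' q' r', [/\ g \is a GRing.unit,
    A * g = g * mx2 P q r P, B * g = g * mx2 P' (- q') (- r') P' &
    symmetric_pair P q r P' q' r'].
Proof.
move=> dA dB tA tB tAB.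
have [||g [s [ug s0 eW]]] := @diagonalize_traceless (A * B - B * A).
- by rewrite raddfB /= (trM2C B) subrr.
- have -> : \det (A * B - B * A) = (4 - (\tr A) ^+ 2 - (\tr B) ^+ 2 - (\tr (A * B)) ^+ 2
      + \tr A * \tr B * \tr (A * B)).
    move: dA dB; rewrite !det2E !tr2E !mxE /= !sum2E => dA dB.
    have -> : forall x y z w : R, 4 - x - y - z + w =
       4 * (A 0 0 * A 1 1 - A 0 1 * A 1 0) * (B 0 0 * B 1 1 - B 0 1 * B 1 0)
       - (B 0 0 * B 1 1 - B 0 1 * B 1 0) * x - (A 0 0 * A 1 1 - A 0 1 * A 1 0) * y - z + w.
      by move=> *; rewrite dA dB; ring.
    ring.
  have : \tr A * \tr B * \tr (A * B) < 0 by rewrite pmulr_rlt0 ?mulr_gt0 //; lra.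
  nra.
have half (M : 'M[R]_2) : \tr (M * (A * B - B * A)) = 0 -> exists p a b,
    M * g = g * mx2 p a b p.
  move=> tM.
  have e : g * (g^-1 * M * g) = M * g by rewrite !mulrA mulrV // mul1r.
  exists ((g^-1 * M * g) 0 0), ((g^-1 * M * g) 0 1), ((g^-1 * M * g) 1 0).
  rewrite -e; congr (_ * _).
  have t0 : \tr (g^-1 * M * g * mx2 s 0 0 (- s)) = 0.
    rewrite -mulrA -eW mulrA -(tr_conj (M * (A * B - B * A)) ug) in tM *.
    by rewrite !mulrA in tM *.
  move: (g^-1 * M * g) t0 => N; rewrite tr2E !mul2E !mx2E => t0.
  have eN : N 0 0 = N 1 1.
    by apply: (mulIf s0); lra.
  by apply: eq_mx2; rewrite !mx2E.
have [|P [q [r eA]]] := half A.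
  by rewrite mulrBr raddfB /= !mulrA (trM2C (A * B)) mulrA subrr.
have [|P' [q' [r' eB]]] := half B.
  by rewrite mulrBr raddfB /= (trM2C B (A * B)) !mulrA (trM2C (B * B)) mulrA subrr.
have dconj (M N : 'M[R]_2) : M * g = g * N -> \det M = \det N.
  move=> e; have := congr1 (fun X : 'M[R]_2 => \det X) e; rewrite !det2M mulrC.
  by apply: mulrI; rewrite -unitmxE.
have tconj (M N : 'M[R]_2) : M * g = g * N -> \tr M = \tr N.
  by move=> e; rewrite -(tr_conj M ug) -mulrA e mulKr.
have eAB : A * B * g = g * (mx2 P q r P * mx2 P' q' r' P').
  by rewrite -mulrA eB !mulrA eA.
move: dA dB tA tB tAB; rewrite (dconj _ _ eA) (dconj _ _ eB).
rewrite (tconj _ _ eA) (tconj _ _ eB) (tconj _ _ eAB).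
rewrite !det2E !tr2E !mul2E !mx2E => dA dB tA tB tAB.
have [|||||h [a [b [c [d [uh e1 e2 sp]]]]]] :=
  @off_diagonal_signs P q r P' (- q') (- r'); [lra|lra|lra|lra|lra|].
exists (g * h), P, a, b, P', c, d; split=> //.
- by rewrite unitrMl.
- by rewrite mulrA eA -!mulrA e1.
- by rewrite mulrA eB -!mulrA; move: e2; rewrite !opprK => ->.
Qed.

End NormalForm.

(** * Transition matrices between the sides of a hexagon *)

Section EntrywiseOrder.
Variable R : realType.
Implicit Types M N : 'M[R]_2.

Definition mx_le M N := forall i j, M i j <= N i j.

Lemma mx_leP M N : M 0 0 <= N 0 0 -> M 0 1 <= N 0 1 -> M 1 0 <= N 1 0 ->
  M 1 1 <= N 1 1 -> mx_le M N.
Proof.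
by move=> h00 h01 h10 h11 i j; case: (ord2P i) => ->; case: (ord2P j) => ->.
Qed.

Lemma mx_le_trans M N L : mx_le M N -> mx_le N L -> mx_le M L.
Proof. by move=> h1 h2 i j; apply: le_trans (h1 i j) (h2 i j). Qed.

Lemma mx_ge0M M N : mx_le 0 M -> mx_le 0 N -> mx_le 0 (M * N).
Proof.
move=> hM hN i j; rewrite mul2E mxE.
by rewrite addr_ge0 ?mulr_ge0 //;
  [have := hM i 0|have := hN 0 j|have := hM i 1|have := hN 1 j];
  rewrite mxE.
Qed.

Lemma mx_leM M M' N N' : mx_le 0 M -> mx_le 0 N -> mx_le M M' -> mx_le N N' ->
  mx_le (M * N) (M' * N').
Proof.
move=> hM hN h h' i j; rewrite !mul2E.
by apply: lerD; apply: ler_pM => //;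
  [have := hM i 0|have := hN 0 j|have := hM i 1|have := hN 1 j];
  rewrite mxE.
Qed.

Lemma mx_le_tr M N : mx_le M N -> \tr M <= \tr N.
Proof. by move=> h; rewrite !tr2E lerD. Qed.

Lemma mx_ge0_trM M N N' : mx_le 0 M -> mx_le N N' -> \tr (N * M) <= \tr (N' * M).
Proof.
move=> hM h; rewrite -subr_ge0 -raddfB /= -mulrBl.
have : mx_le 0 ((N' - N) * M).
  apply: mx_ge0M => // i j; have := h i j; rewrite !mxE; lra.
by move/mx_le_tr; rewrite mxtrace0.
Qed.

End EntrywiseOrder.

(** [None] is the side whose reflection occurs in both generators; [Some false] and
    [Some true] are the sides proper to a and to b.  [next_side] is their cyclic
    order along the circle at infinity. *)
Definition side := option bool.

Definition next_side (i : side) : side :=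
  match i with None => Some false | Some false => Some true | Some true => None end.

Section Hexagon.
Variable R : realType.
Implicit Types M N : 'M[R]_2.

(** For det M = -1 this is - D M^-1 D with D = diag (1, -1): it turns the transition
    from one side to another into the transition back. *)
Definition flip M : 'M[R]_2 := mx2 (M 1 1) (M 0 1) (M 1 0) (M 0 0).

Lemma flipK M : flip (flip M) = M.
Proof. by apply: eq_mx2; rewrite /flip !mx2E. Qed.

Lemma flipM M N : flip (M * N) = flip N * flip M.
Proof. by apply: eq_mx2; rewrite /flip !mul2E !mx2E; ring. Qed.

Lemma tr_flip M : \tr (flip M) = \tr M.
Proof. by rewrite !tr2E /flip !mx2E addrC. Qed.

Lemma mx_le_flip M N : mx_le M N -> mx_le (flip M) (flip N).
Proof. by move=> h; apply: mx_leP; rewrite /flip !mx2E. Qed.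

Variable X : side -> 'M[R]_2.

(** [X i] leads from a side to the next one, and its flip back. *)
Definition transition (i j : side) : 'M[R]_2 :=
  if i == j then 1 else if j == next_side i then X i else flip (X j).

(** The relation says that the three changes of basis between cones compose to -1
    around the circle: with D = diag (1, -1), the change of basis from one cone to the
    next is - D X, and - D X^-1 D is the flip of X when det X = -1. *)
Record hexagon : Prop := Hexagon {
  hex_00 : forall i, 0 <= X i 0 0;
  hex_01 : forall i, 0 < X i 0 1;
  hex_10 : forall i, 0 < X i 1 0;
  hex_11 : forall i, 0 < X i 1 1;
  hex_det : forall i, X i 0 1 * X i 1 0 = X i 0 0 * X i 1 1 + 1;
  hex_rel : forall i, X i * mx2 1 0 0 (-1) * X (next_side i) =
    - flip (X (next_side (next_side i))) }.

Hypothesis hX : hexagon.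

Lemma hex_ge0 i : mx_le 0 (X i).
Proof.
by apply: mx_leP; rewrite !mxE ?(hex_00 hX) // ltW // ?(hex_01 hX) ?(hex_10 hX) ?(hex_11 hX).
Qed.

Lemma transition_ge0 i j : mx_le 0 (transition i j).
Proof.
rewrite /transition; case: eqP => [_|_].
  by apply: mx_leP; rewrite ?id2E mxE.
case: eqP => [_|_]; first exact: hex_ge0.
have -> : 0 = flip (0 : 'M[R]_2) by apply: eq_mx2; rewrite /flip !mx2E !mxE.
exact/mx_le_flip/hex_ge0.
Qed.

Lemma hex_skew i :
  let j := next_side i in let k := next_side j in
  [/\ X i 0 0 * X j 0 0 - X i 0 1 * X j 1 0 = - X k 1 1,
      X i 0 0 * X j 0 1 - X i 0 1 * X j 1 1 = - X k 0 1,
      X i 1 0 * X j 0 0 - X i 1 1 * X j 1 0 = - X k 1 0 &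
      X i 1 0 * X j 0 1 - X i 1 1 * X j 1 1 = - X k 0 0].
Proof.
move=> j k; have := hex_rel hX i; rewrite -/j -/k => /matrixP e.
by split; [have := e 0 0|have := e 0 1|have := e 1 0|have := e 1 1];
  rewrite !mul2E !mx2E !mxE /= => <-; ring.
Qed.

Lemma sideP (i j : side) : i != j ->
  j = next_side i \/ i = next_side j.
Proof. by case: i j => [[]|] [[]|] //= _; first [by left|by right]. Qed.

Lemma transition_next i : transition i (next_side i) = X i.
Proof. by case: i => [[]|]. Qed.

Lemma transition_prev i : transition (next_side i) i = flip (X i).
Proof. by case: i => [[]|]. Qed.

Lemma transition_diag i : transition i i = 1.
Proof. by rewrite /transition eqxx. Qed.

Lemma side_next3 (i : side) : next_side (next_side (next_side i)) = i.
Proof. by case: i => [[]|]. Qed.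

Lemma flip_transition i j : flip (transition i j) = transition j i.
Proof.
have [->|/sideP[->|->]] := eqVneq i j.
- by rewrite transition_diag; apply: eq_mx2; rewrite /flip !mx2E ?id2E.
- by rewrite transition_next transition_prev.
- by rewrite transition_next transition_prev flipK.
Qed.

Lemma side_orientation (i j k : side) : i != j -> j != k -> k != i ->
  (j = next_side i /\ k = next_side j) \/ (j = next_side k /\ i = next_side j).
Proof.
by case: i j k => [[]|] [[]|] [[]|] //= _ _ _; first [by left|by right].
Qed.

(** Writing 1 = - D + 2 E with E = diag (1, 0) and D = diag (1, -1), the product
    X i * X j exceeds - X i * D * X j, the transition from i to k, by
    2 X i * E * X j >= 0. *)
Lemma mx_le_transition_next i : let j := next_side i in let k := next_side j in
  mx_le (transition i k) (X i * X j).
Proof.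
move=> j k; have -> : transition i k = flip (X k).
  by rewrite -[in transition i k](side_next3 i) transition_prev.
have [e1 e2 e3 e4] := hex_skew i; rewrite -/j -/k in e1 e2 e3 e4.
have x00 := hex_00 hX i; have x01 := ltW (hex_01 hX i).
have x10 := ltW (hex_10 hX i); have x11 := ltW (hex_11 hX i).
have y00 := hex_00 hX j; have y01 := ltW (hex_01 hX j).
have := mulr_ge0 x00 y00; have := mulr_ge0 x00 y01.
have := mulr_ge0 x10 y00; have := mulr_ge0 x10 y01.
by move=> *; apply: mx_leP; rewrite mul2E /flip !mx2E; lra.
Qed.

Lemma transition_there_and_back i j : i != j -> mx_le 1 (transition i j * transition j i).
Proof.
have step k : mx_le 1 (X k * flip (X k)) /\ mx_le 1 (flip (X k) * X k).
  have x00 := hex_00 hX k; have x01 := ltW (hex_01 hX k).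
  have x10 := ltW (hex_10 hX k); have x11 := ltW (hex_11 hX k).
  have d := hex_det hX k.
  have := mulr_ge0 x00 x11; have := mulr_ge0 x00 x01.
  have := mulr_ge0 x11 x10; have := mulr_ge0 x00 x10; have := mulr_ge0 x11 x01.
  by move=> *; split; apply: mx_leP; rewrite mul2E /flip !mx2E !id2E; lra.
by case/sideP => ->; rewrite transition_next transition_prev; case: (step i); case: (step j).
Qed.

(** Every entrywise comparison of two sequences of sides follows from this one by
    induction, because the transition from a side to itself is taken to be 1. *)
Lemma transition_triangle i k j : mx_le (transition i j) (transition i k * transition k j).
Proof.
have [<-|ik] := eqVneq i k; first by rewrite transition_diag mul1r.
have [<-|kj] := eqVneq k j; first by rewrite transition_diag mulr1.
have [<-|ji] := eqVneq j i.
  by rewrite transition_diag; apply: transition_there_and_back; rewrite eq_sym.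
case: (side_orientation ik kj ji) => -[-> ->].
  by rewrite !transition_next; apply: mx_le_transition_next.
set k' := next_side j; set i' := next_side k'.
rewrite -(flip_transition j i') -(flip_transition k' i') -(flip_transition j k') -flipM.
by apply: mx_le_flip; rewrite !transition_next; apply: mx_le_transition_next.
Qed.

(** In one orientation, the excess found in [mx_le_transition_next] has a positive
    entry in position (1, 1), and so has the transition closing the cycle; [flip]
    exchanges the orientations. *)
Lemma transition_detour i k j : i != k -> k != j -> j != i ->
  \tr (transition i j * transition j i) < \tr (transition i k * transition k j * transition j i).
Proof.
have inc l : let l' := next_side l in let l'' := next_side l' in
    \tr (transition l l'' * transition l'' l) < \tr (transition l l' * transition l' l'' * transition l'' l).
  move=> l' l''; have el : next_side l'' = l by exact: side_next3.
  have -> : transition l'' l = X l'' by rewrite -el transition_next.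
  have -> : transition l l'' = flip (X l'') by rewrite -{1}el transition_prev.
  rewrite !transition_next.
  have [e1 e2 e3 e4] := hex_skew l; rewrite -/l' -/l'' in e1 e2 e3 e4.
  have x00 := hex_00 hX l; have x10 := hex_10 hX l.
  have y00 := hex_00 hX l'; have y01 := hex_01 hX l'.
  have z00 := hex_00 hX l''; have z01 := ltW (hex_01 hX l'').
  have z10 := ltW (hex_10 hX l''); have z11 := hex_11 hX l''.
  have E : X l * X l' - flip (X l'') = 2 *: mx2 (X l 0 0 * X l' 0 0) (X l 0 0 * X l' 0 1)
      (X l 1 0 * X l' 0 0) (X l 1 0 * X l' 0 1).
    apply: eq_mx2; rewrite [LHS]mxE [X in _ + X]mxE mul2E [RHS]mxE /flip !mx2E; lra.
  rewrite -subr_gt0 -raddfB /= -mulrBl E -scalerAl mxtraceZ tr2E !mul2E !mx2E.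
  rewrite mulr_gt0 //.
  have h1 := mulr_gt0 (mulr_gt0 x10 y01) z11.
  have h2 := mulr_ge0 (mulr_ge0 x00 y00) z00.
  have h3 := mulr_ge0 (mulr_ge0 x00 (ltW y01)) z10.
  have h4 := mulr_ge0 (mulr_ge0 (ltW x10) y00) z01.
  lra.
move=> ik kj ji; case: (side_orientation ik kj ji) => -[ek ej].
  by rewrite ej ek; apply: inc.
have := inc j; rewrite /= -ek -ej trM2C => h; apply: lt_le_trans h _.
by rewrite -tr_flip !flipM !flip_transition trM2C.
Qed.

(** M * flip M - 1 has nonnegative entries, and a positive one in position (1, 0). *)
Lemma tr_zigzag M N : 0 <= M 0 0 -> 0 <= M 0 1 -> 0 < M 1 0 -> 0 < M 1 1 ->
  M 0 1 * M 1 0 = M 0 0 * M 1 1 + 1 -> mx_le 0 N -> 0 < N 0 1 ->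
  \tr N < \tr (M * flip M * N).
Proof.
move=> m00 m01 m10 m11 dM N0 n01.
have E : M * flip M - 1 = 2 *: mx2 (M 0 0 * M 1 1) (M 0 0 * M 0 1)
      (M 1 0 * M 1 1) (M 0 0 * M 1 1).
  by apply: eq_mx2; rewrite [LHS]mxE [X in _ + X]mxE mul2E [RHS]mxE /flip !mx2E ?id2E; lra.
rewrite -subr_gt0 -[X in _ - \tr X]mul1r -raddfB /= -mulrBl E.
rewrite -scalerAl mxtraceZ tr2E !mul2E !mx2E mulr_gt0 //.
have n00 := N0 0 0; have n10 := N0 1 0; have n11 := N0 1 1; rewrite !mxE in n00 n10 n11.
have h1 := mulr_gt0 (mulr_gt0 m10 m11) n01.
have h2 := mulr_ge0 (mulr_ge0 m00 (ltW m11)) n00.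
have h3 := mulr_ge0 (mulr_ge0 m00 m01) n10.
have h4 := mulr_ge0 (mulr_ge0 m00 (ltW m11)) n11.
lra.
Qed.

(** Going back and forth between i and j strictly increases the trace as soon as
    the rest of the sequence visits the third side, even when i and j share an ideal
    vertex, in which case going back and forth is parabolic. *)
Lemma transition_zigzag i j m : i != j -> j != m -> m != i ->
  \tr (transition i j * (transition j m * transition m i)) <
  \tr (transition i j * transition j i * transition i j * (transition j m * transition m i)).
Proof.
have inc l : let l' := next_side l in let l'' := next_side l' in
    \tr (transition l l' * (transition l' l'' * transition l'' l)) <
    \tr (transition l l' * transition l' l * transition l l' * (transition l' l'' * transition l'' l)).
  move=> l' l''; have el : next_side l'' = l by exact: side_next3.
  have -> : transition l'' l = X l'' by rewrite -el transition_next.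
  rewrite !transition_next transition_prev -[X in _ < \tr X]mulrA.
  apply: tr_zigzag;
    rewrite ?(hex_00 hX) ?(hex_10 hX) ?(hex_11 hX) ?(hex_det hX) ?ltW ?(hex_01 hX) //.
    by do 2?apply: mx_ge0M; apply: hex_ge0.
  rewrite !mul2E.
  have x00 := hex_00 hX l; have x01 := hex_01 hX l.
  have y00 := hex_00 hX l'; have y01 := ltW (hex_01 hX l').
  have y10 := hex_10 hX l'; have y11 := ltW (hex_11 hX l').
  have z01 := hex_01 hX l''; have z11 := ltW (hex_11 hX l'').
  have h1 := mulr_gt0 x01 (mulr_gt0 y10 z01).
  have h2 := mulr_ge0 (ltW x01) (mulr_ge0 y11 z11).
  have h3 := mulr_ge0 x00 (mulr_ge0 y00 (ltW z01)).
  have h4 := mulr_ge0 x00 (mulr_ge0 y01 z11).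
  lra.
move=> ij jm mi; case: (side_orientation ij jm mi) => -[ej em].
  by rewrite em ej; apply: inc.
have em' : m = next_side i by rewrite em ej side_next3.
have h := inc j; rewrite /= -em -em' in h.
rewrite -(tr_flip (transition j i * _)) -(tr_flip (transition j i * _ * _ * _)) !flipM !flip_transition in h.
have -> : \tr (transition i j * (transition j m * transition m i)) =
  \tr (transition j m * transition m i * transition i j) by exact: trM2C.
have -> : \tr (transition i j * transition j i * transition i j * (transition j m * transition m i)) =
    \tr (transition j m * transition m i * (transition i j * (transition j i * transition i j))).
  by rewrite trM2C !mulrA.
exact: h.
Qed.

(** Here the sequence stays on i and j; T = T_ij T_ji has T >= 1, and tr T > 2 makes
    one of its diagonal entries greater than 1. *)
Lemma transition_hyperbolic i j : i != j -> 2 < \tr (transition i j * transition j i) ->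
  \tr (transition i j * transition j i) <
  \tr (transition i j * transition j i * transition i j * transition j i).
Proof.
move=> /transition_there_and_back T1; rewrite -mulrA.
move: (transition i j * transition j i) T1 => T T1 T2.
rewrite -subr_gt0 -[X in _ - \tr X]mul1r -raddfB /= -mulrBl tr2E !mul2E !mxE !eqxx /=.
have t00 := T1 0 0; have t01 := T1 0 1; have t10 := T1 1 0; have t11 := T1 1 1.
move: T2 t00 t01 t10 t11; rewrite tr2E !id2E.
move: (T 0 0) (T 0 1) (T 1 0) (T 1 1) => a b c d T2 t00 t01 t10 t11.
have := mulr_ge0 t01 t10; have := sqr_ge0 (a - 1); have := sqr_ge0 (d - 1); nra.
Qed.

End Hexagon.

(** * Reflections in the sides of the hexagon *)

Section ReflectionModel.
Variable R : realType.
Variables a b d a' b' d' : R.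

(** The cones of the sides [None], [Some false], [Some true] have bases
    ((0, -1), (1, 0)), ((b, a), (d, b)) and ((b', d'), (a', b')), with determinant 1;
    [interlaced_order] says that they follow each other counterclockwise. *)
Record interlaced : Prop := Interlaced {
  interlaced_a : 0 <= a; interlaced_b : 0 < b; interlaced_d : 0 < d;
  interlaced_a' : 0 <= a'; interlaced_b' : 0 < b'; interlaced_d' : 0 < d';
  interlaced_det : b ^+ 2 - a * d = 1; interlaced_det' : b' ^+ 2 - a' * d' = 1;
  interlaced_order : b * b' <= d * d' }.

Definition hex_transition (i : side) : 'M[R]_2 :=
  match i with
  | None => mx2 a b b d
  | Some false => mx2 (d * d' - b * b') (d * b' - b * a')
                      (b * d' - a * b') (b * b' - a * a')
  | Some true => mx2 a' b' b' d'
  end.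

Definition mirror (i : side) : 'M[R]_2 :=
  match i with
  | None => mx2 1 0 0 (-1)
  | Some false => mx2 (- (b ^+ 2 + a * d)) (2 * b * d) (- (2 * a * b)) (b ^+ 2 + a * d)
  | Some true => mx2 (- (b' ^+ 2 + a' * d')) (2 * a' * b') (- (2 * b' * d')) (b' ^+ 2 + a' * d')
  end.

(** The columns are the eigenvectors of [mirror i] for -1 and 1, in this order. *)
Definition frame (i : side) : 'M[R]_2 :=
  match i with
  | None => mx2 0 1 (-1) 0
  | Some false => mx2 b d a b
  | Some true => mx2 b' a' d' b'
  end.

Hypothesis hil : interlaced.

Lemma frame_unit i : frame i \is a GRing.unit.
Proof.
apply: det_unit2; case: i => [[]|]; rewrite det2E !mx2E.
- by rewrite -(interlaced_det' hil); ring.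
- by rewrite -(interlaced_det hil); ring.
- by ring.
Qed.

Lemma mirrorK i : mirror i * mirror i = 1.
Proof.
have e : (b ^+ 2 - a * d) ^+ 2 = 1 by rewrite (interlaced_det hil) expr1n.
have e' : (b' ^+ 2 - a' * d') ^+ 2 = 1 by rewrite (interlaced_det' hil) expr1n.
by case: i => [[]|]; apply: eq_mx2; rewrite !mul2E !mx2E !id2E; lra.
Qed.

(** The order of the cones makes the entry (0, 0) of the middle matrix nonnegative;
    the determinants then make its other entries positive. *)
Lemma hex_transition_hexagon : hexagon hex_transition.
Proof.
case: hil => ha hb hd ha' hb' hd' e e' o.
have p1 : 0 < d * b' - b * a'.
  rewrite -(pmulr_lgt0 _ hd').
  have -> : (d * b' - b * a') * d' = b' * (d * d' - b * b') + b * (b' ^+ 2 - a' * d') by ring.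
  by rewrite e' mulr1 ltr_wpDl // mulr_ge0 ?(ltW hb') // subr_ge0.
have p2 : 0 < b * d' - a * b'.
  rewrite -(pmulr_lgt0 _ hd).
  have -> : (b * d' - a * b') * d = b * (d * d' - b * b') + b' * (b ^+ 2 - a * d) by ring.
  by rewrite e mulr1 ltr_wpDl // mulr_ge0 ?(ltW hb) // subr_ge0.
have p3 : 0 < b * b' - a * a'.
  rewrite -(pmulr_lgt0 _ (mulr_gt0 hd hd')).
  have -> : (b * b' - a * a') * (d * d') =
      b * b' * (d * d' - b * b') + (b ^+ 2 - a * d) * b' ^+ 2 + a * d * (b' ^+ 2 - a' * d').
    by ring.
  rewrite e e' mul1r mulr1 -addrA ltr_wpDl //; first by rewrite mulr_ge0 ?subr_ge0 // ltW ?mulr_gt0.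
  by rewrite ltr_pwDl ?exprn_gt0 // mulr_ge0 // ltW.
split.
- by case=> [[]|] /=; rewrite !mx2E // subr_ge0.
- by case=> [[]|] /=; rewrite !mx2E.
- by case=> [[]|] /=; rewrite !mx2E.
- by case=> [[]|] /=; rewrite !mx2E.
- case=> [[]|] /=; rewrite !mx2E; try lra.
  transitivity ((d * d' - b * b') * (b * b' - a * a') + (b ^+ 2 - a * d) * (b' ^+ 2 - a' * d')).
    by ring.
  by rewrite e e' mul1r.
- case=> [[]|] /=; apply: eq_mx2; rewrite [RHS]mxE /flip !mul2E !mx2E; try by ring.
  + by transitivity (- ((b' ^+ 2 - a' * d') * d)); [ring|rewrite e' mul1r].
  + by transitivity (- ((b' ^+ 2 - a' * d') * b)); [ring|rewrite e' mul1r].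
  + by transitivity (- ((b' ^+ 2 - a' * d') * b)); [ring|rewrite e' mul1r].
  + by transitivity (- ((b' ^+ 2 - a' * d') * a)); [ring|rewrite e' mul1r].
  + by transitivity (- ((b ^+ 2 - a * d) * d')); [ring|rewrite e mul1r].
  + by transitivity (- ((b ^+ 2 - a * d) * b')); [ring|rewrite e mul1r].
  + by transitivity (- ((b ^+ 2 - a * d) * b')); [ring|rewrite e mul1r].
  + by transitivity (- ((b ^+ 2 - a * d) * a')); [ring|rewrite e mul1r].
Qed.

Lemma mirror_frame i j : i != j ->
  mirror i * frame j = frame i * transition hex_transition i j \/
  mirror i * frame j = - (frame i * transition hex_transition i j).
Proof.
by case: i j => [[]|] [[]|] //= _; rewrite /transition /= /flip;
  first [by left; apply: eq_mx2; rewrite !mul2E !mx2E; ring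
        |by right; apply: eq_mx2; rewrite [RHS]mxE !mul2E !mx2E; ring].
Qed.

End ReflectionModel.

(** Half-angle formulas: P = cosh (l / 2) = 2 b^2 - 1 with b = cosh (l / 4), where l
    is the length of a, and likewise for the other generator. *)
Lemma symmetric_pair_interlaced (R : realType) (P q r P' q' r' : R) :
  symmetric_pair P q r P' q' r' -> exists a b d a' b' d', [/\ interlaced a b d a' b' d',
    mx2 P q r P = - (mirror a b d a' b' d' (Some false) * mirror a b d a' b' d' None) &
    mx2 P' (- q') (- r') P' = - (mirror a b d a' b' d' None * mirror a b d a' b' d' (Some true))].
Proof.
case=> P1 P1' q0 r0 q0' r0' e e' o.
have half (p : R) : 1 <= p -> exists2 b, 0 < b & p = 2 * b ^+ 2 - 1.
  move=> p1; exists (Num.sqrt ((p + 1) / 2)); first by rewrite sqrtr_gt0; lra.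
  by rewrite sqr_sqrtr; lra.
have [b b0 eP] := half _ P1; have [b' b0' eP'] := half _ P1'.
have nb : b != 0 by rewrite gt_eqF.
have nb' : b' != 0 by rewrite gt_eqF.
exists (r / (2 * b)), b, (q / (2 * b)), (q' / (2 * b')), b', (r' / (2 * b')).
have ad : b ^+ 2 - (r / (2 * b)) * (q / (2 * b)) = 1.
  have -> : r / (2 * b) * (q / (2 * b)) = (q * r) / (4 * b ^+ 2) by field.
  by rewrite e eP; field.
have ad' : b' ^+ 2 - (q' / (2 * b')) * (r' / (2 * b')) = 1.
  have -> : q' / (2 * b') * (r' / (2 * b')) = (q' * r') / (4 * b' ^+ 2) by field.
  by rewrite e' eP'; field.
split.
- split=> //; try by rewrite ?divr_ge0 ?divr_gt0 ?mulr_gt0 ?mulr_ge0 // ltW.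
  have -> : q / (2 * b) * (r' / (2 * b')) = q * r' / (4 * b * b') by field; rewrite nb nb'.
  rewrite ler_pdivlMr ?mulr_gt0 //.
  apply: le_trans o; rewrite eP eP'; lra.
- apply: eq_mx2; rewrite [RHS]mxE !mul2E !mx2E; try (by field); lra.
- apply: eq_mx2; rewrite [RHS]mxE !mul2E !mx2E; try (by field); lra.
Qed.

(** * Products of transitions along sequences of sides *)

Section SidePaths.
Variable R : realType.
Variable X : side -> 'M[R]_2.
Hypothesis hX : hexagon X.
Implicit Types (i j k : side) (s : seq side) (Z : 'M[R]_2).
Local Notation T := (transition X).

Fixpoint path_mx i s : 'M[R]_2 :=
  if s is j :: s' then T i j * path_mx j s' else 1.

Lemma path_mx_cat i s1 s2 :
  path_mx i (s1 ++ s2) = path_mx i s1 * path_mx (last i s1) s2.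
Proof. by elim: s1 i => [|j s IH] i /=; rewrite ?mul1r // IH mulrA. Qed.

Lemma path_mx_ge i s : mx_le (T i (last i s)) (path_mx i s).
Proof.
elim: s i => [|j s IH] i /=; first by rewrite transition_diag.
apply: mx_le_trans (transition_triangle hX i j _) _.
by apply: mx_leM => //; apply: transition_ge0.
Qed.

Lemma path_mx_through i k s : k \in s ->
  mx_le (T i k * T k (last i s)) (path_mx i s).
Proof.
case/splitPr => s1 s2; rewrite -cat_rcons path_mx_cat last_cat last_rcons /=.
have h1 := path_mx_ge i (rcons s1 k); rewrite last_rcons in h1.
apply: mx_leM; [exact: transition_ge0|exact: transition_ge0|exact: h1|exact: path_mx_ge].
Qed.

Lemma tr_lt_mono (N N' Z0 Z : 'M[R]_2) : mx_le N N' -> mx_le Z0 Z ->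
  \tr (N * Z0) < \tr (N' * Z0) -> \tr (N * Z) < \tr (N' * Z).
Proof.
move=> hN hZ; rewrite -subr_gt0 -raddfB /= -mulrBl => h.
rewrite -subr_gt0 -raddfB /= -mulrBl; apply: lt_le_trans h _.
rewrite trM2C [X in _ <= X]trM2C; apply: mx_ge0_trM => // i j.
by have := hN i j; rewrite !mxE; lra.
Qed.

(** The factor Z stands for the rest of a cyclic sequence of sides. *)
Lemma path_detour i k j s Z : i != k -> k != j -> j != i ->
  last i s = j -> k \in s -> mx_le (T j i) Z ->
  \tr (T i j * Z) < \tr (path_mx i s * Z).
Proof.
move=> ik kj ji ls ks hZ.
apply: lt_le_trans (tr_lt_mono (transition_triangle hX i k j) hZ (transition_detour hX ik kj ji)) _.
apply: mx_ge0_trM; first exact: mx_le_trans (transition_ge0 hX _ _) hZ.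
by have := path_mx_through i ks; rewrite ls.
Qed.

Lemma path_back_and_forth i j s : last i s = j ->
  mx_le (T i j * T j i * T i j) (path_mx i (j :: i :: s)).
Proof.
move=> ls /=; rewrite -!mulrA; have T0 := transition_ge0 hX.
apply: mx_leM => //; first exact: mx_ge0M.
by apply: mx_leM => //; have := path_mx_ge i s; rewrite ls.
Qed.

Lemma back_and_forth_ge i j : i != j -> mx_le (T i j) (T i j * T j i * T i j).
Proof.
move=> ij; rewrite -[X in mx_le X _]mul1r; apply: mx_leM => //;
  last exact: transition_there_and_back.
  by move=> k l; rewrite !mxE; case: eqP.
exact: transition_ge0.
Qed.

Lemma path_zigzag i j k s Z : i != j -> j != k -> k != i ->
  last i s = j -> mx_le (T j k * T k i) Z ->
  \tr (T i j * Z) < \tr (path_mx i (j :: i :: s) * Z).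
Proof.
move=> ij jk ki ls hZ.
apply: lt_le_trans (tr_lt_mono (back_and_forth_ge ij) hZ (transition_zigzag hX ij jk ki)) _.
apply: mx_ge0_trM; last exact: path_back_and_forth.
by apply: mx_le_trans hZ; apply: mx_ge0M; apply: transition_ge0.
Qed.

Lemma path_hyperbolic i j s Z : i != j -> 2 < \tr (T i j * T j i) ->
  last i s = j -> mx_le (T j i) Z ->
  \tr (T i j * Z) < \tr (path_mx i (j :: i :: s) * Z).
Proof.
move=> ij t2 ls hZ.
apply: lt_le_trans (tr_lt_mono (back_and_forth_ge ij) hZ (transition_hyperbolic hX ij t2)) _.
apply: mx_ge0_trM; last exact: path_back_and_forth.
exact: mx_le_trans (transition_ge0 hX _ _) hZ.
Qed.

End SidePaths.

(** * The sequence of sides of a word *)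

Section Words.
Implicit Types (x y z : letter) (s t w : word).

Definition core x : side := Some x.1.

(** With a = s1 s0, a^-1 = s0 s1, b = s0 s2 and b^-1 = s2 s0, each letter carries one
    s0, to the left or to the right of its core; between two letters there are thus
    zero, one or two copies of s0, and two cancel. *)
Definition crosses x y : bool := (x.1 == x.2) (+) (y.1 != y.2).

Fixpoint sides_after x s : seq side :=
  if s is y :: s' then
    (if crosses x y then [:: None; core y] else [:: core y]) ++ sides_after y s'
  else [::].

Definition no_cancel x y := y != letter_inv x.

Lemma sides_after_cat x s t :
  sides_after x (s ++ t) = sides_after x s ++ sides_after (last x s) t.
Proof. by elim: s x => [|y s IH] x //=; rewrite IH catA. Qed.

Lemma last_sides_after x s : last (core x) (sides_after x s) = core (last x s).
Proof. by elim: s x => [|y s IH] x //=; rewrite last_cat; case: (crosses x y) => /=. Qed.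

(** After this cancellation no side is repeated: for a word without cancellation,
    letters with the same core are separated by exactly one s0. *)
Lemma path_sides_after x s : path no_cancel x s ->
  path (fun i j => i != j) (core x) (sides_after x s).
Proof.
elim: s x => [|y s IH] x //= /andP [xy /IH ps].
rewrite cat_path; case: ifP xy => /= m.
  by rewrite ps.
by rewrite ps !andbT; case: x y m {IH ps} => [[] []] [[] []].
Qed.

Lemma count_sides_after x s : count (predC1 None) (sides_after x s) = size s.
Proof. by elim: s x => [|y s IH] x //=; rewrite count_cat IH; case: (crosses x y). Qed.

Definition other x : letter := (~~ x.1, x.2).

(** s0 is absent only if the word alternates between the two generators with a
    constant sign of the exponents, that is, runs around the third boundary. *)
Lemma fpath_other x s : path no_cancel x s -> None \notin sides_after x s ->
  fpath other x s.
Proof.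
elim: s x => [|y s IH] x //= /andP [xy ps]; rewrite mem_cat negb_or => /andP [m nN].
by rewrite IH // andbT; case: x y xy m {IH ps nN} => [[] []] [[] []].
Qed.

Lemma fpath_other_sign x s : fpath other x s -> (last x s).2 = x.2.
Proof. by elim: s x => [|y s IH] x //= /andP [/eqP <- /IH ->]. Qed.

Lemma fpath_other_power x s : fpath other x (rcons s x) ->
  exists n, x :: s = flatten (nseq n [:: x; other x]).
Proof.
have [m] := ubnP (size s); elim: m s => // m IH [|y [|z s]] /=.
- by rewrite andbT; case: x {IH} => [[] []].
- by move=> _ /andP [/eqP <- _]; exists 1.
rewrite !ltnS => hm /and3P [/eqP <- /eqP <-].
have otherK : involutive other by case=> [[] []].
rewrite otherK.
move=> /(IH _ (ltnW hm)) [n e]; exists n.+1.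
by rewrite /= -e.
Qed.

Lemma power_third_boundary x n :
  third_boundary_power (flatten (nseq n [:: x; other x])).
Proof.
exists [:: x; other x], n; split=> //.
by case: x => [[] []]; rewrite !inE /=.
Qed.

End Words.

(** * Filling the gap between the last and the first letter *)

Section Comparison.
Variable R : realType.
Variable X : side -> 'M[R]_2.
Hypothesis hX : hexagon X.
Implicit Types (x y : letter) (s v : word).
Local Notation T := (transition X).

Lemma side_third (i j k l : side) : i != j -> j != k -> k != i ->
  l != i -> l != k -> l = j.
Proof. by case: i j k l => [[]|] [[]|] [[]|] [[]|]. Qed.

(** If the inserted sides avoid k, they go back and forth between i and j. *)
Lemma direct_gap_lt (i j k : side) W M : i != j -> j != k -> k != i ->
  path (fun i j => i != j) i W -> last i W = j -> W != [:: j] ->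
  mx_le (T j i) M ->
  [\/ k \in W, mx_le (T j k * T k i) M | 2 < \tr (T i j * T j i)] ->
  \tr (T i j * M) < \tr (path_mx X i W * M).
Proof.
move=> ij jk ki pW lW cW hM alt.
have [kW|kW] := boolP (k \in W).
  by apply: (path_detour hX (k := k)) => //; rewrite eq_sym.
case: W pW lW cW kW alt => [|l [|m W]] /=; first by move=> _ e; rewrite e eqxx in ij.
  by move=> _ ->; rewrite eqxx.
rewrite !inE !negb_or => /and3P [il lm _] lW _ /and3P [kl km kW].
have el : l = j by apply: (side_third ij jk ki); rewrite eq_sym.
have em : m = i by apply: (@side_third j i k); rewrite 1?eq_sym // -el.
rewrite el em (negbTE kW) orbF in lW kl km *.
case=> [|hM2|t2]; first by rewrite (negbTE kl) (negbTE km).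
  exact: (path_zigzag hX (k := k)).
exact: path_hyperbolic.
Qed.

(** Around the side k of the original sequence there are two gaps to fill; as W is
    longer than [:: k; j], one of them is filled by more than nothing. *)
Lemma marked_gap_lt (i j k : side) W M : i != j -> j != k -> k != i ->
  path (fun i j => i != j) i W -> last i W = j -> W != [:: k; j] ->
  mx_le (T j i) M -> k \in W ->
  \tr (T i k * T k j * M) < \tr (path_mx X i W * M).
Proof.
move=> ij jk ki pW lW cW hM kW.
have T0 := transition_ge0 hX; have M0 : mx_le 0 M := mx_le_trans (T0 _ _) hM.
case: W pW lW cW kW => // l W /= /andP [il pW] lW cW kW.
have [ek|lk] := eqVneq l k.
  rewrite ek in pW lW cW *.
  rewrite -!mulrA trM2C [X in _ < X]trM2C -!mulrA.
  have hM2 : mx_le (T j i * T i k) (M * T i k) by apply: mx_leM.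
  apply: (@direct_gap_lt k j i) => //; rewrite 1?eq_sym //.
  - by apply: contra cW => /eqP ->.
  - exact: mx_le_trans (transition_triangle hX j i k) hM2.
  - exact: Or32.
have el : l = j by apply: (side_third ij jk ki) => //; rewrite eq_sym.
rewrite el in pW lW kW *.
move: kW; rewrite inE (eq_sym k j) (negbTE jk) /= => /splitPr kW.
case: kW pW lW => W1 W2 _; rewrite last_cat /= => lW.
rewrite -cat_rcons path_mx_cat last_rcons.
have hM2 : mx_le (T k j * M) (path_mx X k W2 * M).
  by apply: mx_leM => //; rewrite -lW; apply: path_mx_ge.
rewrite -!mulrA; apply: (@le_lt_trans _ _ (\tr (T i k * (path_mx X k W2 * M)))).
  rewrite trM2C [X in _ <= X]trM2C; apply: mx_ge0_trM => //.
rewrite (mulrA (T i j)).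
apply: (@path_detour _ X hX i j k (j :: rcons W1 k)) => //; rewrite 1?eq_sym ?inE ?eqxx //=.
  by rewrite last_rcons.
apply: mx_le_trans hM2; apply: mx_le_trans (transition_triangle hX k j i) _.
exact: mx_leM.
Qed.

(** The gap lies between the last letter y of u = x :: s and its first letter x.  If
    y and x are separated by s0, the inserted sides contain s0 as well: a word from y to
    x without s0 would keep the sign of the exponents, and then no s0 would separate y
    from x either. *)
Lemma path_trace_lt x s v : let y : letter := last x s in
  y != x -> no_cancel y x -> path no_cancel x (s ++ rcons v x) -> v != [::] ->
  None \in sides_after x (s ++ rcons v x) \/
    2 < \tr (T (Some false) (Some true) * T (Some true) (Some false)) ->
  \tr (path_mx X (core x) (sides_after x (rcons s x))) <
  \tr (path_mx X (core x) (sides_after x (s ++ rcons v x))).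
Proof.
move=> y yx nyx pth v0 alt.
have cyx : core y != core x.
  by move: yx nyx; rewrite /no_cancel; case: (y) (x) => [[] []] [[] []].
move: pth; rewrite cat_path -/y => /andP [_ pth].
have pW := path_sides_after pth.
have lW : last (core y) (sides_after y (rcons v x)) = core x.
  by rewrite last_sides_after last_rcons.
have cW := count_sides_after y (rcons v x).
have sW : (1 < count (predC1 None) (sides_after y (rcons v x)))%N.
  by rewrite cW size_rcons ltnS lt0n size_eq0.
have WN : crosses y x -> None \in sides_after y (rcons v x).
  apply: contraTT => nW; have := fpath_other_sign (fpath_other pth nW).
  rewrite last_rcons; move: cyx; rewrite /core /crosses.
  by case: (y) (x) => [[] []] [[] []].
rewrite -(cats1 s x) !sides_after_cat -/y in alt *.
set Z := sides_after x s in alt *.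
have lZ : last (core x) Z = core y by rewrite last_sides_after.
have -> : sides_after y [:: x] = if crosses y x then [:: None; core x] else [:: core x].
  by rewrite /= cats0.
rewrite !path_mx_cat lZ.
move: alt WN pW lW sW; set W := sides_after y (rcons v x) => alt WN pW lW sW {cW pth}.
have hZ : mx_le (T (core x) (core y)) (path_mx X (core x) Z).
  by rewrite -lZ; apply: path_mx_ge.
have hZN : None \in Z -> mx_le (T (core x) None * T None (core y)) (path_mx X (core x) Z).
  by move=> NZ; rewrite -lZ; apply: path_mx_through.
move: alt hZ hZN; rewrite mem_cat; move: (None \in Z) => NZ.
move: (path_mx X (core x) Z) => M alt hM hMN.
have t2 : 2 < \tr (T (Some false) (Some true) * T (Some true) (Some false)) ->
    2 < \tr (T (core y) (core x) * T (core x) (core y)).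
  by move: cyx; rewrite /core; case: (y.1) (x.1) => [] [] //; rewrite trM2C.
have W1 : W != [:: core x].
  by apply: contraTneq sW => ->.
have W2 : W != [:: None; core x].
  by apply: contraTneq sW => ->.
case: ifP WN => [m /(_ isT) NW|m _] /=; rewrite mulr1 trM2C [ltRHS]trM2C.
  exact: marked_gap_lt.
apply: (direct_gap_lt (k := None)) => //.
case: alt => [|/t2]; last exact: Or33.
by case/orP => [/hMN|]; [exact: Or32|exact: Or31].
Qed.

End Comparison.

(** * Traces of words as traces of products of transitions *)

Section UpToSign.
Variable R : realType.
Implicit Types M N L : 'M[R]_2.

Definition pm_eq M N := M = N \/ M = - N.

Lemma pm_eqM M M' N N' : pm_eq M M' -> pm_eq N N' -> pm_eq (M * N) (M' * N').
Proof.
by case=> ->; case=> ->; rewrite ?mulrN ?mulNr ?opprK; [left|right|right|left].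
Qed.

Lemma pm_eq_trans M N L : pm_eq M N -> pm_eq N L -> pm_eq M L.
Proof. by case=> ->; case=> ->; rewrite ?opprK; [left|right|right|left]. Qed.

Lemma pm_eq_tr M N : pm_eq M N -> (\tr M) ^+ 2 = (\tr N) ^+ 2.
Proof. by case=> -> //; rewrite raddfN sqrrN. Qed.

Lemma pm_eq_conj_tr M N (g : 'M[R]_2) : g \is a GRing.unit ->
  pm_eq (M * g) (g * N) -> (\tr M) ^+ 2 = (\tr N) ^+ 2.
Proof.
move=> ug h; rewrite -(tr_conj M ug); apply: pm_eq_tr.
have -> : N = g^-1 * (g * N) by rewrite mulKr.
by rewrite -mulrA; apply: pm_eqM => //; left.
Qed.

End UpToSign.

Section TraceFormula.
Variable R : realType.
Variables X S V : side -> 'M[R]_2.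
Hypothesis VU : forall i, V i \is a GRing.unit.
Hypothesis SK : forall i, S i * S i = 1.
Hypothesis SV : forall i j, i != j -> pm_eq (S i * V j) (V i * transition X i j).
Implicit Types (x y z : letter) (s w : word) (i j : side).

Fixpoint mirror_path i (s : seq side) : 'M[R]_2 :=
  if s is j :: s' then S i * mirror_path j s' else 1.

Lemma mirror_path_frame i (s : seq side) : path (fun i j => i != j) i s ->
  pm_eq (mirror_path i s * V (last i s)) (V i * path_mx X i s).
Proof.
elim: s i => [|j s IH] i /=; first by rewrite mul1r mulr1; left.
move=> /andP [ij /IH h]; rewrite -mulrA.
apply: pm_eq_trans (pm_eqM (or_introl (erefl (S i))) h) _.
by rewrite !mulrA; apply: pm_eqM; [apply: SV|left].
Qed.

Definition head_mirror x : 'M[R]_2 := if x.1 == x.2 then 1 else S None.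
Definition tail_mirror x : 'M[R]_2 := if x.1 == x.2 then S None else 1.
Definition letter_mirrors x := head_mirror x * S (core x) * tail_mirror x.

(** Regrouping the product of reflections so that each s0 stands between the cores
    of two letters, where s0 s0 = 1 cancels. *)
Lemma mirror_path_word x s z :
  S (core x) * tail_mirror x * \prod_(y <- s) letter_mirrors y * head_mirror z =
  mirror_path (core x) (sides_after x (rcons s z)).
Proof.
have step a b : S (core a) * tail_mirror a * head_mirror b =
    S (core a) * (if crosses a b then S None else 1).
  rewrite /tail_mirror /head_mirror /crosses.
  by do 2!case: (_ == _); rewrite /= ?mulr1 ?mul1r // -mulrA SK mulr1.
elim: s x => [|y s IH] x.
  by rewrite big_nil mulr1 step /=; case: (crosses x z); rewrite /= ?mulr1.
rewrite big_cons /= {1}/letter_mirrors.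
have -> : S (core x) * tail_mirror x *
    (head_mirror y * S (core y) * tail_mirror y * \prod_(j <- s) letter_mirrors j) *
    head_mirror z = (S (core x) * tail_mirror x * head_mirror y) *
    (S (core y) * tail_mirror y * \prod_(j <- s) letter_mirrors j * head_mirror z).
  by rewrite !mulrA.
by rewrite IH step; case: (crosses x y); rewrite /= ?mulr1 ?mulrA.
Qed.

(** Moving the s0 on the left of the first letter to the end of the product closes
    the sequence of sides into a cycle. *)
Lemma tr_word x s : path no_cancel x (rcons s x) ->
  (\tr (\prod_(y <- x :: s) letter_mirrors y)) ^+ 2 =
  (\tr (path_mx X (core x) (sides_after x (rcons s x)))) ^+ 2.
Proof.
move=> /path_sides_after/mirror_path_frame; rewrite last_sides_after last_rcons.
move/(pm_eq_conj_tr (VU _)) => <-; rewrite big_cons /letter_mirrors -!mulrA trM2C.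
by rewrite -mirror_path_word !mulrA.
Qed.

Variables A B g : 'M[R]_2.
Hypothesis gU : g \is a GRing.unit.
Hypothesis detA : \det A = 1.
Hypothesis detB : \det B = 1.
Hypothesis eA : pm_eq (A * g) (g * (S (Some false) * S None)).
Hypothesis eB : pm_eq (B * g) (g * (S None * S (Some true))).

Lemma rep_letter_mirrors x : pm_eq (rep_letter A B x * g) (g * letter_mirrors x).
Proof.
have inv M L L' : \det M = 1 -> L * L' = 1 -> pm_eq (M * g) (g * L) ->
    pm_eq (M^-1 * g) (g * L').
  move=> dM LL h; have uM := det_unit2 dM.
  have -> : M^-1 * g = M^-1 * (g * L) * L' by rewrite -!mulrA LL mulr1.
  have -> : g * L' = M^-1 * (M * g) * L' by rewrite mulKr.
  apply: pm_eqM; last by left.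
  apply: pm_eqM; first by left.
  by case: h => ->; rewrite ?opprK; [left|right; rewrite opprK].
have SSK i j : S i * S j * (S j * S i) = 1.
  by rewrite mulrA -(mulrA (S i)) SK mulr1 SK.
rewrite /letter_mirrors /head_mirror /tail_mirror /rep_letter /core.
case: x => [[] []] /=; rewrite ?mulr1 ?mul1r //.
  by apply: inv eB.
by apply: inv eA.
Qed.

Lemma rep_mirrors w :
  pm_eq (rep A B w * g) (g * \prod_(y <- w) letter_mirrors y).
Proof.
elim: w => [|x w IH]; first by rewrite rep_nil big_nil mul1r mulr1; left.
rewrite rep_cons big_cons -mulrA.
apply: pm_eq_trans (pm_eqM (or_introl (erefl _)) IH) _.
rewrite mulrA [X in pm_eq _ X]mulrA; apply: pm_eqM; last by left.
exact: rep_letter_mirrors.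
Qed.

Lemma tr_rep x s : path no_cancel x (rcons s x) ->
  (\tr (rep A B (x :: s))) ^+ 2 =
  (\tr (path_mx X (core x) (sides_after x (rcons s x)))) ^+ 2.
Proof.
by move=> ps; rewrite (pm_eq_conj_tr gU (rep_mirrors (x :: s))) tr_word.
Qed.

End TraceFormula.

Section Main.
Variable R : realType.

(** Replacing A and B by their negatives where needed makes tr A and tr B positive,
    hence tr A B negative, and changes the traces of words by signs only. *)
Lemma pants_hexagon (P : hyperbolic_pants R) : exists2 X : side -> 'M[R]_2, hexagon X &
  forall x s, path no_cancel x (rcons s x) ->
    (\tr (rep (hol_a P) (hol_b P) (x :: s))) ^+ 2 =
    (\tr (path_mx X (core x) (sides_after x (rcons s x)))) ^+ 2.
Proof.
have [tA tB tAB neg] := pants_traces P.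
have dA := det_hol_a P; have dB := det_hol_b P.
move: (hol_a P) (hol_b P) tA tB tAB neg dA dB => A B tA tB tAB neg dA dB.
have signed (M : 'M[R]_2) : \det M = 1 -> 4 <= (\tr M) ^+ 2 ->
    exists M', [/\ pm_eq M M', 2 <= \tr M', \det M' = 1 &
      exists e, [/\ 0 < e * \tr M, M' = e *: M & e ^+ 2 = 1]].
  move=> dM tM; have [t0|t0] := leP 0 (\tr M).
    exists M; split=> //; [by left|nra|].
    by exists 1; rewrite mul1r scale1r expr1n; split=> //; nra.
  exists (- M); split; [by right; rewrite opprK| |by rewrite -dM !det2E !mxE; ring|].
    rewrite raddfN /=; nra.
  by exists (-1); rewrite mulN1r scaleN1r sqrrN expr1n oppr_gt0.
have [A' [pA tA' dA' [e [e0 eA e2]]]] := signed A dA tA.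
have [B' [pB tB' dB' [f [f0 fB f2]]]] := signed B dB tB.
have tAB' : \tr (A' * B') <= - 2.
  rewrite eA fB -scalerAl -scalerAr scalerA mxtraceZ.
  have n1 : (e * f * \tr (A * B)) ^+ 2 = (\tr (A * B)) ^+ 2.
    by rewrite !exprMn e2 f2 !mul1r.
  have n2 : e * f * \tr (A * B) < 0.
    rewrite -(pmulr_rlt0 _ (mulr_gt0 e0 f0)).
    have -> : e * \tr A * (f * \tr B) * (e * f * \tr (A * B)) =
      e ^+ 2 * f ^+ 2 * (\tr A * \tr B * \tr (A * B)) by ring.
    by rewrite e2 f2 !mul1r.
  nra.
have [g [p [q [r [p' [q' [r' [ug gA gB sp]]]]]]]] := pants_normal_form dA' dB' tA' tB' tAB'.
have [a [b [d [a' [b' [d' [il mA mB]]]]]]] := symmetric_pair_interlaced sp.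
exists (hex_transition a b d a' b' d'); first exact: hex_transition_hexagon.
move=> x s ps; apply: (tr_rep (frame_unit il) (mirrorK il) _ ug dA dB) => //.
- by move=> i j ij; apply: mirror_frame.
- apply: pm_eq_trans (pm_eqM pA (or_introl (erefl g))) _.
  by rewrite gA mA mulrN; right.
- apply: pm_eq_trans (pm_eqM pB (or_introl (erefl g))) _.
  by rewrite gB mB mulrN; right.
Qed.

End Main.

Lemma letter_invK : involutive letter_inv.
Proof. by case=> [[] []]. Qed.

Theorem theorem1p3 (R : realType) (u v : word)
  (hu : cyclically_reduced u) (hv : cyclically_reduced v)
  (hv0 : v <> [::])
  (huv : cyclically_reduced (u ++ v))
  (hends : starts_and_ends_differently u)
  (X : hyperbolic_pants R)
  (hcusp : ~ cusp_power X (u ++ v)) :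
  geodesic_length X u < geodesic_length X (u ++ v).
Proof.
case: u hu huv hends hcusp => // x s; rewrite cat_cons.
move=> /andP [pu lu] /andP [puv luv] yx hcusp.
have closed w : reduced (x :: w) -> last x w != letter_inv x ->
    path no_cancel x (rcons w x).
  move=> pw lw; rewrite rcons_path; apply/andP; split; first exact: pw.
  by apply: contra lw => /eqP/(congr1 letter_inv); rewrite letter_invK => ->.
have cu := closed s pu lu; have cuv := closed (s ++ v) puv luv.
have [Y hY trY] := pants_hexagon X.
set A := hol_a X in trY *; set B := hol_b X in trY *.
have dA : \det A = 1 := det_hol_a X; have dB : \det B = 1 := det_hol_b X.
have tr2 w : 2 <= \tr (path_mx Y (core x) (sides_after x (rcons w x))).
  have := path_mx_ge hY (core x) (sides_after x (rcons w x)).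
  rewrite last_sides_after last_rcons transition_diag => /mx_le_tr.
  by rewrite tr2E !id2E.
apply: ltr_translation_length; rewrite ?det_rep //.
  by rewrite trY //; have := tr2 s; nra.
rewrite !trY // ltr_sqr ?nnegrE; [|by apply: le_trans (tr2 s)|by apply: le_trans (tr2 (s ++ v))].
rewrite rcons_cat; apply: path_trace_lt => //.
- by move: cu; rewrite rcons_path => /andP [].
- by rewrite -rcons_cat.
- exact/eqP.
rewrite -rcons_cat.
have [|nN] := boolP (None \in _); [by left|right].
have ab : path no_cancel letter_a (rcons [:: letter_b] letter_a) by [].
rewrite lt_neqAle; apply/andP; split; last first.
  have := transition_there_and_back hY (isT : Some false != Some true) => /mx_le_tr.
  by rewrite tr2E !id2E.
(* Trace 2 makes AB parabolic, and without s0 the word uv is a power of ab up to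
   cyclic permutation and inversion. *)
apply/eqP => t2; apply: hcusp; split; last first.
  have [n ->] := fpath_other_power (fpath_other cuv nN).
  exact: power_third_boundary.
apply: translation_length_parabolic; first by rewrite det_rep.
by rewrite (trY _ _ ab) /= mulr1 -t2; ring.
Qed.
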